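(* Let $\mathbb{X},\mathbb{Y},\mathbb{U}$ be compact. Suppose that: (A) $Q(\cdot|x)$ is weakly continuous in $x$ and $\mathcal{T}(\cdot|x,u)$ is weakly continuous in $(x,u)$; (B) the stochastic kernel $\kappa(dx|s)=P(X_t\in dx|S_t=s)$ is weakly continuous in $s$ (product topology); (C) the filter $\pi_t$ is $\sigma(S_t)$-measurable; in particular, independently of the control policy, there is a measurable $g$ with $g(S_t)(A)=\pi_t(A)$ for every Borel $A\subset\mathbb{X}$. Then, for every $\beta\in(0,1)$, an optimal solution to the discounted cost problem exists: there is a solution $J_\beta$ to the discounted cost optimality equation $$J_\beta(s)=\min_{u\in\mathbb{U}}\Big(\bar c(s,u)+\beta\int J_\beta(s')\,\mathbb{P}^d(ds'|s,u)\Big),\qquad s\in\mathbb{Y}^{\mathbb{Z}_-}\times\mathbb{U}^{\mathbb{Z}_-},$$ and a measurable minimizing selector $\gamma$, so that the stationary policy $U_t=\gamma(S_t)$ minimizes $E[\sum_{t\ge0}\beta^t c(X_t,U_t)\,|\,S_0=s]$ over all policies for which $U_t$ is a measurable function of $S_t$ for each $t$.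
   Context: Model: $\mathbb{X}$, $\mathbb{Y}$ are standard Borel (Polish) spaces and $\mathbb{U}$ is a metric action space. $X_{t+1}=F(X_t,U_t,W_t)$, $Y_t=G(X_t,V_t)$ with mutually independent i.i.d. noise sequences; $\mathcal{T}(B|x,u)=P(X_1\in B|X_0=x,U_0=u)$, $Q(C|x)=P(Y_0\in C|X_0=x)$. The stage cost $c:\mathbb{X}\times\mathbb{U}\to\mathbb{R}_+$ is bounded and continuous. Infinite past: measurements and actions are assumed to have been taking place since $-\infty$. $\mathbb{Y}^{\mathbb{Z}_-}$ and $\mathbb{U}^{\mathbb{Z}_-}$ are one-sided products over $\{\dots,-2,-1,0\}$ with the product topology; $u_{(-\infty,-1]}$ is viewed as an element of $\mathbb{U}^{\mathbb{Z}_-}$. Put $S_t=(Y_{(-\infty,t]},U_{(-\infty,t-1]})\in\mathbb{Y}^{\mathbb{Z}_-}\times\mathbb{U}^{\mathbb{Z}_-}$. $\kappa(dx|s)$ denotes the stochastic kernel $P(X_t\in dx|S_t=s)$. The filter satisfies, for every $n$, $\pi_t(A)=E[1_{\{X_t\in A\}}\,|\,\sigma(S_t)\vee\sigma(\pi_{(-\infty,-n]})]$. $\bar c(s,u)=E[c(X_t,u)|S_t=s]=\int c(x,u)\kappa(dx|s)$. $\mathbb{P}^d(\cdot|s,u)$ is the transition kernel of $S_t$: given $S_t=s$, $U_t=u$, $S_{t+1}$ appends $u$ to the action history and $Y_{t+1}\sim\int\kappa(dx|s)\int\mathcal{T}(dx'|x,u)Q(\cdot|x')$ to the measurement history. *)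

(* Defs.v *)
From HB Require Import structures.
From mathcomp Require Import all_boot all_order all_algebra.
From mathcomp Require Import all_classical all_reals all_analysis.
Import Order.TTheory GRing.Theory Num.Theory.
Import numFieldNormedType.Exports.

Set Implicit Arguments.
Unset Strict Implicit.
Unset Printing Implicit Defensive.

Local Open Scope classical_set_scope.
Local Open Scope ring_scope.

(* Measurable types of the library are pointed, hence nonempty metric spaces. *)
#[short(type="pmetricType")]
HB.structure Definition PointedMetric (K : numDomainType) :=
  { M of Metric K M & Pointed M }.

Definition borel (T : ptopologicalType) := g_sigma_algebraType (@open T).
HB.instance Definition _ (T : ptopologicalType) := Measurable.on (borel T).

(* Y^{Z_-} x U^{Z_-} with the product topology; the coordinate [n : nat] of a
   one-sided sequence stands for the time index [-n]. *)
Definition history (R : realType) (Y U : pmetricType R) : Type :=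
  ({ptws nat -> Y} * {ptws nat -> U})%type.
HB.instance Definition _ (R : realType) (Y U : pmetricType R) :=
  PseudoMetric.copy (history Y U) ({ptws nat -> Y} * {ptws nat -> U})%type.
HB.instance Definition _ (R : realType) (Y U : pmetricType R) :=
  Pointed.copy (history Y U) ({ptws nat -> Y} * {ptws nat -> U})%type.

Definition extend (R : realType) (Y U : pmetricType R)
    (s : history Y U) (u : U) (y : Y) : history Y U :=
  (fun n => if n is m.+1 then s.1 m else y,
   fun n => if n is m.+1 then s.2 m else u).

Definition weakly_continuous (R : realType) (A : topologicalType)
    (B : ptopologicalType) (k : A -> {measure set (borel B) -> \bar R}) : Prop :=
  forall f : B -> R, continuous f -> (exists M, forall b, `|f b| <= M) ->
    continuous (fun a => \int[k a]_(b in setT) f b).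

Definition is_min (R : realType) (T : Type) (f : T -> R) (m : R) : Prop :=
  (exists u, f u = m) /\ (forall u, m <= f u).

Section sigma_algebras.
Context d (Omega : measurableType d) (R : realType) (P : probability Omega R).

Definition sigma_of d' (T : measurableType d') (f : Omega -> T)
  : set (set Omega) := preimage_set_system setT f measurable.

Definition sigma_join (F G : set (set Omega)) : set (set Omega) :=
  <<s F `|` G >>.

Definition sigma_joins (I : Type) (D : set I) (F : I -> set (set Omega))
  : set (set Omega) := <<s \bigcup_(i in D) F i >>.

Definition independent (F G : set (set Omega)) : Prop :=
  forall A B, F A -> G B -> P (A `&` B) = (P A * P B)%E.

Definition mutually_independent (I : eqType) (F : I -> set (set Omega)) : Prop :=
  forall (s : seq I) (A : I -> set Omega), uniq s ->
    (forall i, i \in s -> F i (A i)) ->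
    P (\bigcap_(i in [set` s]) A i) = (\prod_(i <- s) P (A i))%E.

Record is_cond_exp (G : set (set Omega)) (Z E : Omega -> R) : Prop := {
  cond_exp_measurable : forall B : set R, measurable B -> G (E @^-1` B) ;
  cond_exp_integrable : P.-integrable setT (EFin \o E) ;
  cond_exp_integral : forall A, G A ->
    (\int[P]_(w in A) (E w)%:E = \int[P]_(w in A) (Z w)%:E)%E }.

End sigma_algebras.

Section model.
Context (R : realType) (X Y U : pmetricType R).
Context dW dV (W : measurableType dW) (V : measurableType dV).
Context (F : borel X * borel U * W -> borel X) (G : borel X * V -> borel Y).
Context (muW : probability W R) (muV : probability V R).

Local Notation S := (history Y U).

Section process.
Context d (Omega : measurableType d) (P : probability Omega R).

Record system := System {
  state : int -> Omega -> borel X ;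
  observation : int -> Omega -> borel Y ;
  action : int -> Omega -> borel U ;
  state_noise : int -> Omega -> W ;
  observation_noise : int -> Omega -> V }.

Variable z : system.

(* S_t = (Y_{(-oo,t]}, U_{(-oo,t-1]}) *)
Definition info (t : int) (w : Omega) : borel S :=
  (fun n : nat => observation z (t - n%:Z) w,
   fun n : nat => action z (t - 1 - n%:Z) w).

Definition past (t : int) : set (set Omega) :=
  sigma_joins [set r : int | r <= t] (fun r =>
    sigma_join (sigma_of (state z r))
      (sigma_join (sigma_of (observation z r)) (sigma_of (action z r)))).

(* the noise entering strictly after the observation at time t *)
Definition future_noise (t : int) : set (set Omega) :=
  sigma_joins [set r : int | t <= r] (fun r =>
    sigma_join (sigma_of (state_noise z r))
               (sigma_of (observation_noise z (r + 1)))).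

Definition noise (i : int + int) : set (set Omega) :=
  match i with
  | inl t => sigma_of (state_noise z t)
  | inr t => sigma_of (observation_noise z t)
  end.

(* A process with infinite past under the policy [U_t = rho_t(S_t)]. With no
   initial time, the independence of the initial condition and the noise becomes
   the independence, at every time, of the past and the future noise. *)
Record controlled (rho : int -> borel S -> borel U) : Prop := {
  policy_measurable : forall t, measurable_fun setT (rho t) ;
  state_measurable : forall t, measurable_fun setT (state z t) ;
  observation_measurable : forall t, measurable_fun setT (observation z t) ;
  action_measurable : forall t, measurable_fun setT (action z t) ;
  state_noise_measurable : forall t, measurable_fun setT (state_noise z t) ;
  observation_noise_measurable :
    forall t, measurable_fun setT (observation_noise z t) ;
  state_noise_law : forall t A, measurable A ->
    P (state_noise z t @^-1` A) = muW A ;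
  observation_noise_law : forall t A, measurable A ->
    P (observation_noise z t @^-1` A) = muV A ;
  noise_independent : mutually_independent P noise ;
  nonanticipative : forall t, independent P (past t) (future_noise t) ;
  state_equation : forall t w,
    state z (t + 1) w = F (state z t w, action z t w, state_noise z t w) ;
  observation_equation : forall t w,
    observation z t w = G (state z t w, observation_noise z t w) ;
  control_equation : forall t w, action z t w = rho t (info t w) }.

Definition conditional_law (kappa : borel S -> {measure set (borel X) -> \bar R})
    : Prop :=
  forall t (A : set (borel X)), measurable A ->
    is_cond_exp P (sigma_of (info t)) \1_(state z t @^-1` A)
      (fun w => fine (kappa (info t w) A)).

Definition filter_past (pi : int -> Omega -> pprobability (borel X) R)
    (t : int) : set (set Omega) :=
  sigma_joins [set r : int | r <= t] (fun r => sigma_of (pi r)).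

(* The condition [- n <= t] keeps the values of the filter after time t, which
   depend on observations made after time t, out of the conditioning. *)
Record is_filter (pi : int -> Omega -> pprobability (borel X) R) : Prop := {
  filter_measurable : forall t, measurable_fun setT (pi t) ;
  filter_nonanticipative : forall t,
    independent P (sigma_join (past t) (filter_past pi t)) (future_noise t) ;
  filter_equation : forall (t : int) (n : nat) (A : set (borel X)),
    - n%:Z <= t -> measurable A ->
    exists2 E, is_cond_exp P
        (sigma_join (sigma_of (info t)) (filter_past pi (- n%:Z)))
        \1_(state z t @^-1` A) E
      & \forall w \ae P, fine (pi t w A) = E w }.

Definition total_cost (c : X * U -> R) (beta : R) (w : Omega) : R :=
  limn (series (fun t : nat =>
    beta ^+ t * c (state z t%:Z w, action z t%:Z w))).

End process.

Context (c : X * U -> R).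
Context (kappa : R.-pker (borel S) ~> (borel X)).
Context (T : R.-pker (borel X * borel U)%type ~> (borel X)).
Context (Q : R.-pker (borel X) ~> (borel Y)).

Definition state_kernel_of : Prop :=
  forall x u (B : set (borel X)), measurable B ->
    T (x, u) B = muW [set w | B (F (x, u, w))].

Definition observation_kernel_of : Prop :=
  forall x (C : set (borel Y)), measurable C ->
    Q x C = muV [set v | C (G (x, v))].

Definition cbar (s : S) (u : U) : R := \int[kappa s]_(x in setT) c (x, u).

Definition is_history_kernel
    (Pd : R.-pker (borel S * borel U)%type ~> (borel S)) : Prop :=
  forall s u (A : set (borel S)), measurable A ->
    (Pd (s, u) A =
     \int[kappa s]_x \int[T (x, u)]_x' Q x' [set y | A (extend s u y)])%E.

Context (Pd : R.-pker (borel S * borel U)%type ~> (borel S)).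

Definition bellman (beta : R) (J : S -> R) (s : S) (u : U) : R :=
  cbar s u + beta * \int[Pd (s, u)]_(s' in setT) J s'.

(* E[\sum_(t < n) beta^t cbar(S_t, rho_t(S_t)) | S_0 = s] for the chain S_t with
   transition kernel Pd started at the point s; unlike a version of a conditional
   expectation given S_0, it is determined at every s. *)
Fixpoint expected_cost (beta : R) (n : nat) (rho : nat -> S -> U) (s : S) : R :=
  if n is m.+1 then
    bellman beta (expected_cost beta m (fun t => rho t.+1)) s (rho 0%N s)
  else 0.

End model.

(* Main.v *)
(* The history space S = Y^{Z_-} x U^{Z_-} is compact and second countable. As
   X, Y and U are compact, weak continuity of kappa, T and Q makes
   (s, u) |-> cbar(s, u) + beta * \int J dPd(s, u) continuous for continuous J, so
   value iteration started at 0 stays among continuous functions, increases by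
   at most beta^n * K at step n, and converges uniformly to a continuous solution
   J of the optimality equation; a measurable minimizing selector exists because
   the sets of minimizers have a closed graph over a compact space. Since the
   noise driving step t is independent of (S_t, X_t) and kappa is the conditional
   law of X_t given S_t, the process S_t is a controlled chain with kernel Pd, and
   iterating the optimality equation on an event A of sigma(S_0) compares
   \int_A J(S_0) with \int_A \sum_t beta^t c(X_t, U_t). *)

From HB Require Import structures.
Require Import Defs.
From mathcomp Require Import all_boot all_order all_algebra.
From mathcomp Require Import all_classical all_reals all_analysis.
From mathcomp Require Import measurable_realfun.
From mathcomp Require Import ring lra.
Import Order.TTheory GRing.Theory Num.Theory.
Import numFieldNormedType.Exports.

Set Implicit Arguments.
Unset Strict Implicit.
Unset Printing Implicit Defensive.

Local Open Scope classical_set_scope.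
Local Open Scope ring_scope.

(** * Borel sets and compactness *)

(** Two sigma-algebras compete on products: the Borel sets of the product topology, as in
    [borel (history Y U)], and the product of Borel sigma-algebras, as in the domain
    [borel X * borel U] of [T]. Second countability, a consequence of compactness, reconciles them.
    Since the cost is nonnegative, the identities that link kernels, noise and processes are proved
    for nonnegative measurable functions; they reduce to agreement of measures on measurable sets or
    rectangles and need no integrability. Comparisons are made up to an error [beta ^+ n * M], where
    [M = K / (1 - beta)] is the discounted total of a constant cost [K] bounding [c]. One lemma on
    geometric increments serves value iteration, the finite-horizon costs and the partial sums of
    the realised cost. Optimality is proved twice, independently. At every single history [s], it
    follows by induction on the horizon of [expected_cost], shifting the policy at each step. For
    processes, conditional expectations are determined only almost surely, so the comparison is
    integrated over events of sigma(S_0) and then localised. *)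

Lemma borel_open (T : ptopologicalType) (V : set T) :
  open V -> measurable (V : set (borel T)).
Proof. by move=> oV; exact: sub_sigma_algebra. Qed.

Lemma borel_closed (T : ptopologicalType) (V : set T) :
  closed V -> measurable (V : set (borel T)).
Proof. by move=> /closed_openC/borel_open/measurableC; rewrite setCK. Qed.

Lemma measurable_fun_borel d (Omega : measurableType d) (T : ptopologicalType)
    (f : Omega -> borel T) :
  (forall V : set T, open V -> measurable (f @^-1` V)) -> measurable_fun setT f.
Proof.
move=> fO; apply: (@measurability _ _ _ (borel T) setT f (@open T)) => // _ [V oV <-].
by rewrite setTI; exact: fO.
Qed.

(** [R] carries its own measurable structure, distinct from [borel R]; its generating open intervals
    are open sets, so testing open sets suffices. *)
Lemma measurable_fun_real d (Omega : measurableType d) (R : realType)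
    (f : Omega -> R) :
  (forall V : set R, open V -> measurable (f @^-1` V)) -> measurable_fun setT f.
Proof.
move=> fO; apply: (measurability _ (RGenOpens.measurableE R)).
move=> _ [_ [a [b ->]] <-]; rewrite setTI; apply: fO.
exact: interval_open.
Qed.

Lemma measurable_continuous (R : realType) (Z : ptopologicalType) (f : Z -> R) :
  continuous f -> measurable_fun setT (f : borel Z -> R).
Proof.
move=> cf; apply: measurable_fun_real => A oA; apply: borel_open.
by apply: open_comp => // z _; exact: cf.
Qed.

Lemma countable_bigcup_measurable d (T : measurableType d) (I : Type)
    (D : set I) (F : I -> set T) : countable D ->
  (forall i, D i -> measurable (F i)) -> measurable (\bigcup_(i in D) F i).
Proof.
move=> cD mF; rewrite bigcup_set_type; apply: countable_bigcupT_measurable.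
  by rewrite (eq_countable (card_setT D)).
by move=> i; apply: mF; exact: set_valP.
Qed.

(** Countable bases of both factors make [V] a countable union of open rectangles; an uncountable
    union could leave the product sigma-algebra. *)
Lemma open_prod_measurable (A B : ptopologicalType) (V : set (A * B)) :
  @second_countable A -> @second_countable B -> open V ->
  measurable (V : set (borel A * borel B)%type).
Proof.
move=> [BA cBA [oBA bA]] [BB cBB [oBB bB]] oV.
pose D := [set p : set A * set B | [/\ BA p.1, BB p.2 & p.1 `*` p.2 `<=` V]].
have -> : V = \bigcup_(p in D) (p.1 `*` p.2).
  apply/seteqP; split=> [[a b] Vab|ab [p [_ _ pV] /pV]//].
  have [[QA QB] /= [nA nB] QV] : nbhs (a, b) V by apply: open_nbhs_nbhs.
  have [VA [BVA VAa] VAQ] := bA a QA nA.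
  have [VB [BVB VBb] VBQ] := bB b QB nB.
  exists (VA, VB) => //=; split => //= -[x y] [/= /VAQ ? /VBQ ?].
  by apply: QV.
apply: countable_bigcup_measurable => [|p [Bp1 Bp2 _]].
  by apply: sub_countable (countableX cBA cBB); apply: subset_card_le => p [].
by apply: measurableX; apply: borel_open; [exact: oBA|exact: oBB].
Qed.

(* Countably many members of the possibly uncountable base [N] exhaust each open
   set: one [W b] between each useful member [b] of a countable base and [V]. *)
Lemma measurable_fun_basis d (Omega : measurableType d) (T : ptopologicalType)
    (f : Omega -> borel T) (N : set (set T)) : @second_countable T ->
  (forall (x : T) (A : set T), nbhs x A ->
    exists V : set T, [/\ N V, nbhs x V & V `<=` A]) ->
  (forall V, N V -> measurable (f @^-1` V)) ->
  measurable_fun setT f.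
Proof.
move=> [B cB [oB bB]] bN mN; apply: measurable_fun_borel => V oV.
pose D := [set b | B b /\ exists W, [/\ N W, b `<=` W & W `<=` V]].
pose W b := xget set0 [set W | [/\ N W, b `<=` W & W `<=` V]].
have WP b : D b -> [/\ N (W b), b `<=` W b & W b `<=` V].
  move=> [_ [W0 W0P]].
  exact: (@xgetPex _ set0 [set W | [/\ N W, _ & _]] (ex_intro _ W0 W0P)).
have -> : V = \bigcup_(b in D) W b.
  apply/seteqP; split=> [x Vx|x [b /WP[_ _ WV] /WV]//].
  have [W0 [NW0 nW0 W0V]] := bN x V (open_nbhs_nbhs (conj oV Vx)).
  have [b [Bb bx] bW0] := bB x W0 nW0.
  have Db : D b by split => //; exists W0.
  by exists b => //; have [_ + _] := WP _ Db; exact.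
rewrite preimage_bigcup; apply: countable_bigcup_measurable.
  by apply: sub_countable cB; apply: subset_card_le => b [].
by move=> b /WP[/mN].
Qed.

(** * The compact space of one-sided histories *)

Section history.
Context (R : realType) (Y U : pmetricType R).
Hypotheses (Y_compact : compact [set: Y]) (U_compact : compact [set: U]).

Lemma ptws_compact (Z : pmetricType R) : compact [set: Z] ->
  compact [set: {ptws nat -> Z}].
Proof.
move=> cZ; have := @tychonoff nat (fun=> Z) _ (fun=> cZ).
by congr (compact _); exact/seteqP.
Qed.

Lemma history_compact : compact [set: history Y U].
Proof.
by rewrite -setXTT; apply: compact_setX; exact: ptws_compact.
Qed.

Lemma history_second_countable : @second_countable (history Y U).
Proof. exact: compact_second_countable history_compact. Qed.

(** A basic neighbourhood is a finite intersection of open cylinders, so only finitely many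
    coordinates of [f] matter. Quantifying over [f] expresses the measurability of [V] without a
    sigma-algebra on the sequence space. *)
Lemma ptws_basis (Z : pmetricType R) (x : {ptws nat -> Z}) A : nbhs x A ->
  exists V, [/\ nbhs x V, V `<=` A &
    forall d (Omega : measurableType d) (f : Omega -> {ptws nat -> Z}),
      (forall n, measurable_fun setT (fun w => f w n : borel Z)) ->
      measurable (f @^-1` V)].
Proof.
move=> [P [[Q QfinP <-] [V JV Vx]] PA].
exists V; split => //.
- exists V => //; split=> //; exists [set V]; last by rewrite bigcup_set1.
  by move=> _ ->; exact: QfinP.
- by move=> y Vy; apply: PA; exists V.
move=> d Omega f mf; have [L Lsub <-] := QfinP _ JV.
rewrite preimage_bigcap.
apply: fin_bigcap_measurable => [|M LM]; first exact: finite_fset.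
have /set_mem[n _ [W oW <-]] := Lsub M LM.
by have := mf n measurableT W (borel_open oW); rewrite setTI.
Qed.

Lemma measurable_fun_history d (Omega : measurableType d)
    (f : Omega -> borel (history Y U)) :
  (forall n, measurable_fun setT (fun w => (f w).1 n : borel Y)) ->
  (forall n, measurable_fun setT (fun w => (f w).2 n : borel U)) ->
  measurable_fun setT f.
Proof.
move=> mf1 mf2.
(* The base consists of all sets with measurable preimage, so it only remains to find such sets
   inside each neighbourhood. *)
apply: (@measurable_fun_basis _ _ _ f (fun V => measurable (f @^-1` V))) => //.
  exact: history_second_countable.
move=> [x1 x2] A [[Q1 Q2] /= [nQ1 nQ2] QA].
have [V1 [nV1 VQ1 mV1]] := ptws_basis nQ1.
have [V2 [nV2 VQ2 mV2]] := ptws_basis nQ2.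
exists (V1 `*` V2); split.
- have := measurableI _ _ (mV1 _ _ (fun w => (f w).1) mf1)
    (mV2 _ _ (fun w => (f w).2) mf2); by [].
- by exists (V1, V2).
- by move=> [y1 y2] [/= /VQ1 ? /VQ2 ?]; exact: QA.
Qed.

Lemma history_proj1_continuous n : continuous (fun s : history Y U => s.1 n).
Proof.
move=> s; apply: (@continuous_comp (history Y U) {ptws nat -> Y} Y fst (fun f => f n)).
  exact: cvg_fst.
exact: (@proj_continuous nat (fun=> Y) n).
Qed.

Lemma history_proj2_continuous n : continuous (fun s : history Y U => s.2 n).
Proof.
move=> s; apply: (@continuous_comp (history Y U) {ptws nat -> U} U snd (fun f => f n)).
  exact: cvg_snd.
exact: (@proj_continuous nat (fun=> U) n).
Qed.

Lemma ptws_cvg (Z : pmetricType R) (A : Type) (F : set_system A)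
    (FF : Filter F) (f : A -> {ptws nat -> Z}) (l : {ptws nat -> Z}) :
  (forall n, f a n @[a --> F] --> l n) -> f @ F --> l.
Proof.
move=> fl.
exact/(@pointwise_cvgP nat Z (f @ F) l).
Qed.

Lemma extend_continuous :
  continuous (fun p : history Y U * U * Y => extend p.1.1 p.1.2 p.2).
Proof.
move=> [[s u] y].
apply: (@cvg_pair _ _ _ _ (nbhs (extend s u y).1) (nbhs (extend s u y).2)).
  apply: ptws_cvg => -[|n] /=; first exact: cvg_snd.
  apply: (@cvg_comp _ _ _ (fun p : history Y U * U * Y => p.1.1)
    (fun s : history Y U => s.1 n)); last exact: history_proj1_continuous.
  by apply: (@cvg_comp _ _ _ fst fst); exact: cvg_fst.
apply: ptws_cvg => -[|n] /=.
  by apply: (@cvg_comp _ _ _ fst snd); [exact: cvg_fst|exact: cvg_snd].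
apply: (@cvg_comp _ _ _ (fun p : history Y U * U * Y => p.1.1)
  (fun s : history Y U => s.2 n)); last exact: history_proj2_continuous.
by apply: (@cvg_comp _ _ _ fst fst); exact: cvg_fst.
Qed.

End history.

(** * Bounded functions under a measure of mass one *)

Section bounded_integrals.
Context d (T : measurableType d) (R : realType) (m : {measure set T -> \bar R}).
Hypothesis m1 : m setT = 1%E.

(** Mass one is a hypothesis on [m] and not a [probability] structure because kernel values such as
    [kappa s] are typed as plain measures. *)
Lemma bounded_integrable (A : set T) (f : T -> R) (M : R) : measurable A ->
  measurable_fun setT f -> (forall x, `|f x| <= M) ->
  m.-integrable A (EFin \o f).
Proof.
move=> mA mf fM; apply: measurable_bounded_integrable => //.
- apply: (@le_lt_trans _ _ (m setT)); last by rewrite m1 ltry.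
  by apply: le_measure; rewrite ?inE.
- exact: measurable_funTS.
- exists M; split; first exact: num_real.
  by move=> N /ltW MN x _; exact: le_trans (fM x) MN.
Qed.

Lemma Rintegral_prob_cst (r : R) : \int[m]_(x in setT) r = r.
Proof. by rewrite /Rintegral integral_cst// m1 mule1. Qed.

Lemma Rintegral_dist (f g : T -> R) (M N e : R) :
  measurable_fun setT f -> (forall x, `|f x| <= M) ->
  measurable_fun setT g -> (forall x, `|g x| <= N) ->
  (forall x, `|f x - g x| <= e) ->
  `|\int[m]_(x in setT) f x - \int[m]_(x in setT) g x| <= e.
Proof.
move=> mf fM mg gN fg.
have If := bounded_integrable measurableT mf fM.
have Ig := bounded_integrable measurableT mg gN.
rewrite -RintegralB//; apply: le_trans (le_normr_Rintegral _ _) _ => //.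
  exact: (integrableB measurableT If Ig).
rewrite -[leRHS]Rintegral_prob_cst; apply: le_Rintegral => //.
- apply: (@bounded_integrable _ (fun x => `|f x - g x|) e) => //.
    by apply: measurableT_comp => //; exact: measurable_funB.
  by move=> x; rewrite normr_id.
- by apply: (@bounded_integrable _ (cst e) `|e|) => //.
Qed.

Lemma Rintegral_mono (f g : T -> R) (M N : R) :
  measurable_fun setT f -> (forall x, `|f x| <= M) ->
  measurable_fun setT g -> (forall x, `|g x| <= N) ->
  (forall x, f x <= g x) ->
  \int[m]_(x in setT) f x <= \int[m]_(x in setT) g x.
Proof.
move=> mf fM mg gN fg.
have If := bounded_integrable measurableT mf fM.
have Ig := bounded_integrable measurableT mg gN.
by apply: le_Rintegral => //.
Qed.

Lemma EFin_Rintegral (f : T -> R) (M : R) :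
  measurable_fun setT f -> (forall x, `|f x| <= M) ->
  (\int[m]_(x in setT) f x)%:E = (\int[m]_(x in setT) (f x)%:E)%E.
Proof.
move=> mf fM; rewrite /Rintegral fineK//.
exact/(integrable_fin_num measurableT)/(bounded_integrable measurableT mf fM).
Qed.

End bounded_integrals.

(** * Continuity of integrals in the measure and in a parameter *)

Section compact_parameters.
Context (R : realType).

Lemma compact_range_bounded (B : ptopologicalType) (f : B -> R) :
  compact [set: B] -> continuous f -> exists M : R, forall b, `|f b| <= M.
Proof.
move=> cB cf.
have [||b _ bM] := @compact_EVT_max B R (fun b => `|f b|) setT _ cB.
- by exists point.
- by apply: continuous_subspaceT => b; apply: cvg_norm; exact: cf.
by exists `|f b| => b'; apply: bM; rewrite inE.
Qed.

(** Tube argument: a product neighbourhood of [(b, c)] keeps both [f (b', c')] and [f (b', c)]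
    within [e / 2] of [f (b, c)], and compactness of [B] yields one neighbourhood of [c] for all
    [b]. *)
Lemma compact_uniform (B C : topologicalType) (f : B * C -> R) (c : C) (e : R) :
  compact [set: B] -> continuous f -> 0 < e ->
  \forall c' \near c, forall b, `|f (b, c') - f (b, c)| < e.
Proof.
move=> /compact_near_coveringP cB cf e0.
have H : \forall c' \near c, setT `<=` (fun b => `|f (b, c') - f (b, c)| < e).
  apply: cB => b _.
  have e20 : 0 < e / 2 by rewrite divr_gt0.
  have /cvgrPdist_lt/(_ _ e20) [[Q1 Q2] /= [nQ1 nQ2] Q] := cf (b, c).
  exists (Q1, Q2) => // -[b' c'] /= [Q1b Q2c].
  have h1 : `|f (b, c) - f (b', c')| < e / 2 by apply: Q.
  have h2 : `|f (b, c) - f (b', c)| < e / 2.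
    by apply: Q; split => //=; exact: nbhs_singleton.
  rewrite (_ : f (b', c') - f (b', c) =
    (f (b, c) - f (b', c)) - (f (b, c) - f (b', c'))); last by ring.
  by rewrite (le_lt_trans (ler_normB _ _))// (splitr e) ltrD.
by apply: filterS H => c' H b; apply: H.
Qed.

(** Weak continuity speaks of a fixed integrand, whereas here integrand and measure move together.
    The measure is moved first with [f (_, c)] fixed; then the integrand is moved under [k a'],
    where uniform closeness over the compact [B] and mass one bound the change. *)
Lemma weakly_continuous_param (A C : topologicalType) (B : ptopologicalType)
    (k : A -> {measure set (borel B) -> \bar R}) (f : B * C -> R) :
  compact [set: B] -> (forall a, k a setT = 1%E) -> weakly_continuous k ->
  continuous f ->
  continuous (fun p : A * C => \int[k p.1]_(b in setT) f (b, p.2)).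
Proof.
move=> cB k1 wk cf [a c].
have cfc c' : continuous (fun b => f (b, c')).
  move=> b; apply: (@continuous_comp _ _ _ (fun b => (b, c')) f); last exact: cf.
  by apply: cvg_pair => //=; exact: cvg_cst.
have mfc c' : measurable_fun setT ((fun b => f (b, c')) : borel B -> R).
  by apply: measurable_fun_real => V oV; apply: borel_open; apply: open_comp.
have bfc c' := compact_range_bounded cB (cfc c').
apply/cvgrPdist_lt => e e0 /=; have e20 : 0 < e / 2 by rewrite divr_gt0.
have /cvgrPdist_lt/(_ _ e20) H1 := wk _ (cfc c) (bfc c) a.
have H2 := compact_uniform c cB cf e20.
exists ([set t | `|\int[k a]_(b in setT) f (b, c) -
    \int[k t]_(b in setT) f (b, c)| < e / 2],
  [set c' | forall b, `|f (b, c') - f (b, c)| < e / 2]) => //.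
move=> [a' c'] /= [h1 h2].
set x := \int[k a]_(b in setT) _; set y := \int[k a']_(b in setT) _.
set z := \int[k a']_(b in setT) f (b, c) in h1.
have h3 : `|z - y| <= e / 2.
  have [M1 M1P] := bfc c; have [M2 M2P] := bfc c'.
  apply: (Rintegral_dist (k1 a') (mfc c) M1P (mfc c') M2P) => b.
  by rewrite distrC ltW.
rewrite (_ : x - y = (x - z) + (z - y)); last by ring.
by rewrite (le_lt_trans (ler_normD _ _))// (splitr e) ltr_leD.
Qed.

End compact_parameters.

(** * Measurable selection and minimization over a compact space *)

Lemma nested_compact_bigcap (U : topologicalType) (E : nat -> set U) :
  compact [set: U] -> (forall n, closed (E n)) -> (forall n, E n !=set0) ->
  (forall m n, (m <= n)%N -> E n `<=` E m) -> \bigcap_n E n !=set0.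
Proof.
move=> cU cE E0 Edec.
pose u n := projT1 (cid (E0 n)).
have uE n : E n (u n) by rewrite /u; case: cid.
have [p [_ up]] := cU (u @ \oo) _ filterT.
exists p => m _; apply: cE => B nB; rewrite setIC setIC; apply: up => //.
by exists m => // n /= mn; apply: Edec mn _ _.
Qed.

(* The [K n] are closed and separate the points of [U]. Starting from [D s], keep
   the part in [K n] whenever it is nonempty: the decreasing compact sets [E n s]
   shrink to a single point, and [g s \in C] holds iff every [E n s] meets [C]. *)
Lemma measurable_selection d (S : measurableType d) (R : realType)
    (U : pmetricType R) (D : S -> set U) :
  compact [set: U] -> (forall s, closed (D s)) -> (forall s, D s !=set0) ->
  (forall C : set U, closed C -> measurable [set s | D s `&` C !=set0]) ->
  exists g : S -> borel U, measurable_fun setT g /\ forall s, D s (g s).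
Proof.
move=> cU cD D0 mD.
have [B /countable_injP[f finj] [oB bB]] := compact_second_countable cU.
(* [K n] is the complement of the base set with code [n], and all of [U] when [n] codes none; [f] is
   injective on [B], so codes are unambiguous. *)
pose K n := [set u : U | forall b, B b -> f b = n -> ~ b u].
have cK n : closed (K n).
  rewrite (_ : K n = \bigcap_(b in [set b | B b /\ f b = n]) ~` b).
    by apply: closed_bigI => b [Bb _]; apply: open_closedC; exact: oB.
  apply/seteqP; split => [u Ku b [Bb fb]|u Ku b Bb fb]; first exact: Ku.
  by apply: Ku.
pose E := fix E (n : nat) (s : S) {struct n} : set U := if n is m.+1 then
  (if `[< E m s `&` K m !=set0 >] then E m s `&` K m else E m s) else D s.
have cE n s : closed (E n s).
  by elim: n => //= n IH; case: ifP => // _; exact: closedI.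
have E0 n s : E n s !=set0.
  by elim: n => //= n IH; case: asboolP.
have ES n s : E n.+1 s `<=` E n s by move=> u /=; case: ifP => // _ [].
have Edec s m n : (m <= n)%N -> E n s `<=` E m s.
  by move=> /subnK<-; elim: (n - m)%N => // k IH; apply: subset_trans IH; exact: ES.
(* The induction ranges over all closed [C], since the step calls it at the intersection of [K n]
   with [C]: either [E n s] meets that set, or it misses [K n] and meets [C]. *)
have mE n (C : set U) : closed C -> measurable [set s | E n s `&` C !=set0].
  elim: n C => [|n IH] C cC; first exact: mD.
  rewrite (_ : [set s | _] = [set s | E n s `&` (K n `&` C) !=set0] `|`
    ([set s | E n s `&` C !=set0] `\` [set s | E n s `&` K n !=set0])).
    by apply: measurableU; [|apply: measurableD]; apply: IH => //; exact: closedI.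
  apply/seteqP; split => s /=.
    case: asboolP => h; last by right.
    by rewrite -setIA; left.
  case: asboolP => h; first by case; [rewrite setIA|case].
  case; last by case.
  by case=> u [Eu [Ku _]]; exfalso; apply: h; exists u.
have uE s (p q : U) : (\bigcap_n E n s) p -> (\bigcap_n E n s) q -> p = q.
  move=> Ep Eq; apply: contrapT => pq.
  have [b [Bb bq] bp] : filter_from [set V | B V /\ V q] id (~` [set p]).
    apply: bB; apply: open_nbhs_nbhs; split; last by move=> /= /esym.
    apply: closed_openC; apply: accessible_closed_set1.
    by apply: hausdorff_accessible; exact: metric_hausdorff.
  have Kp : K (f b) p.
    move=> b' Bb' fb'; rewrite (finj b' b) ?inE// => /bp.
    exact.
  (* The point [p] shows that [E (f b) s] meets [K (f b)], so the next stage keeps only points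
     outside [b]; this excludes [q]. *)
  have := Eq (f b).+1 I; rewrite /=; case: asboolP => [_|[]].
    by move=> [_ /(_ b Bb erefl)].
  by exists p; split => //; exact: Ep.
have ne s : exists p, (\bigcap_n E n s) p.
  by apply: nested_compact_bigcap => //; exact: Edec.
pose g s := projT1 (cid (ne s)).
have gE s : (\bigcap_n E n s) (g s) by rewrite /g; case: cid.
exists g; split; last by move=> s; exact: (gE s 0%N I).
apply: measurable_fun_borel => V oV.
rewrite -(setCK (g @^-1` V)); apply: measurableC.
rewrite (_ : ~` _ = \bigcap_n [set s | E n s `&` ~` V !=set0]).
  by apply: bigcapT_measurable => n; apply: mE; exact: open_closedC.
apply/seteqP; split => s /=.
  by move=> Vg n _; exists (g s); split => //; exact: gE.
move=> Vs; have [|||p pE] := @nested_compact_bigcap _ (fun n => E n s `&` ~` V) cU.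
- by move=> n; apply: closedI => //; exact: open_closedC.
- by move=> n; exact: Vs.
- by move=> m n mn u [/(Edec _ _ _ mn)].
rewrite (uE s (g s) p) //; first by have [] := pE 0%N I.
by move=> n _; have [] := pE n I.
Qed.

(** Outside the projection [h] is positive on all of [{s}] times [C], and compactness of [C]
    preserves this for nearby [s]. It supplies the measurability hypothesis of
    [measurable_selection] for sets of minimizers. *)
Lemma closed_sublevel_projection (R : realType) (S U : topologicalType)
    (C : set U) (h : S * U -> R) : compact C -> continuous h ->
  closed [set s | [set u | h (s, u) <= 0] `&` C !=set0].
Proof.
move=> /compact_near_coveringP cC ch; rewrite -openC openE => s /= sh.
have H : \forall s' \near s, C `<=` (fun u => 0 < h (s', u)).
  apply: cC => u Cu.
  have hsu : 0 < h (s, u) by rewrite ltNge; apply/negP => hle; apply: sh; exists u.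
  have /cvgrPdist_lt/(_ _ hsu) [[Q1 Q2] /= [nQ1 nQ2] Q] := ch (s, u).
  exists (Q2, Q1) => // -[u' s'] /= [Q2u Q1s].
  have := Q (s', u') (conj Q1s Q2u); rewrite /= ltr_norml => /andP[_].
  by rewrite ltrBlDl ltrDr.
apply: filterS H => s' H [u [/= hle Cu]].
by have := H u Cu; rewrite ltNge hle.
Qed.

(** For [s'] near [s] the functions [h (s, _)] and [h (s', _)] differ by less than [e] uniformly in
    [u]; evaluating each at the minimizer of the other bounds the gap between the minima. *)
Lemma is_min_continuous (R : realType) (S U : topologicalType)
    (h : S * U -> R) (J : S -> R) : compact [set: U] -> continuous h ->
  (forall s, is_min (fun u => h (s, u)) (J s)) -> continuous J.
Proof.
move=> cU ch hJ s; apply/cvgrPdist_le => e e0.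
have chs : continuous (fun p : U * S => h (p.2, p.1)).
  move=> p; apply: (@continuous_comp _ _ _ (fun p : U * S => (p.2, p.1)) h);
    last exact: ch.
  by apply: cvg_pair; [exact: cvg_snd|exact: cvg_fst].
apply: filterS (compact_uniform s cU chs e0) => s' /= hs.
have [[u <-] uJ] := hJ s; have [[u' <-] uJ'] := hJ s'.
have := hs u; have := hs u'; have := uJ u'; have := uJ' u.
rewrite !ltr_norml ler_norml => h1 h2 /andP[h3 h4] /andP[h5 h6].
by apply/andP; split; lra.
Qed.

Lemma is_min_exists (R : realType) (S : topologicalType) (U : ptopologicalType)
    (h : S * U -> R) (s : S) : compact [set: U] -> continuous h ->
  exists m, is_min (fun u => h (s, u)) m.
Proof.
move=> cU ch; have [||u _ uM] := @compact_EVT_min U R (fun u => h (s, u)) setT _ cU.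
- by exists point.
- apply: continuous_subspaceT => u.
  apply: (@continuous_comp _ _ _ (fun u => (s, u)) h); last exact: ch.
  by apply: cvg_pair => //=; exact: cvg_cst.
exists (h (s, u)); split; first by exists u.
by move=> u'; apply: uM; rewrite inE.
Qed.

(** * Kernels *)

Lemma finite_measure_prod_unique d1 d2 (T1 : measurableType d1)
    (T2 : measurableType d2) (R : realType) (m1 m2 : {measure set (T1 * T2) -> \bar R}) :
  (m1 setT < +oo)%E ->
  (forall A B, measurable A -> measurable B -> m1 (A `*` B) = m2 (A `*` B)) ->
  forall C, measurable C -> m1 C = m2 C.
Proof.
move=> m1oo m12 C mC.
apply: (measure_unique [set A `*` B | A in measurable & B in measurable]
  (fun=> setT)) => //.
- exact: measurable_prod_measurableType.
- move=> _ _ [A1 mA1 [B1 mB1 <-]] [A2 mA2 [B2 mB2 <-]].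
  exists (A1 `&` A2); first exact: measurableI.
  exists (B1 `&` B2); first exact: measurableI.
  by rewrite -setXI.
- by move=> _; exists setT => //; exists setT => //; exact: setXTT.
- by rewrite bigcup_const.
- by move=> _ [A mA [B mB <-]]; exact: m12.
Qed.

Section kernel_probability.
Context d d' (A : measurableType d) (B : measurableType d') (R : realType)
  (k : R.-pker A ~> B) (a : A).

Let mu : set B -> \bar R := k a.
HB.instance Definition _ := Measure.on mu.
Let mu1 : mu setT = 1%E. Proof. exact: prob_kernel. Qed.
HB.instance Definition _ := @Measure_isProbability.Build _ _ R mu mu1.
(** Equips [k a] with the structure needed to form its product with the law of the noise and to
    apply Tonelli. *)
Definition kernel_probability : probability B R := mu.

End kernel_probability.

Section kernel_graph.
Context d d' (A : measurableType d) (B : measurableType d') (R : realType)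
  (k : R.-pker A ~> B).

Let mpair (a : A) : measurable_fun setT (pair a : B -> A * B).
Proof. exact: pair1_measurable. Qed.

(* [delta_a (x) k a], with a dummy first argument so that it can be composed
   with a constant kernel by [mkcomp]. *)
Definition kernel_graph (p : A * A) : {measure set (A * B)%type -> \bar R}.
Proof.
by refine (pushforward (k p.2) (pair p.2)); exact: mpair.
Defined.

Lemma kernel_graphE p C : kernel_graph p C = k p.2 (pair p.2 @^-1` C).
Proof. by []. Qed.

Let kernel_graph_measurable (C : set (A * B)) : measurable C ->
  measurable_fun setT (kernel_graph ^~ C).
Proof.
move=> mC; apply: (measurableT_comp (f := fun a => k a (pair a @^-1` C))) measurable_snd.
rewrite (_ : (fun a => _) = (fun a => \int[k a]_b (\1_C (a, b))%:E)%E).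
  apply: (measurable_fun_integral_finite_kernel (fun p => (\1_C p)%:E) k) => //.
  by apply/measurable_EFinP; exact: measurable_indic.
apply/funext => a; rewrite (_ : (fun b => _) = EFin \o \1_(pair a @^-1` C))//.
rewrite integral_indic ?setIT//.
by rewrite -(setTI (_ @^-1` _)); exact: mpair.
Qed.

HB.instance Definition _ :=
  isKernel.Build _ _ _ _ _ kernel_graph kernel_graph_measurable.

Let kernel_graph1 p : kernel_graph p setT = 1%E.
Proof. by rewrite kernel_graphE preimage_setT prob_kernel. Qed.

HB.instance Definition _ :=
  Kernel_isProbability.Build _ _ _ _ _ kernel_graph kernel_graph1.

Lemma integral_kernel_graph p (f : A * B -> \bar R) :
  (forall x, 0 <= f x)%E -> measurable_fun setT f ->
  (\int[kernel_graph p]_x f x = \int[k p.2]_b f (p.2, b))%E.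
Proof.
by move=> f0 mf; rewrite ge0_integral_pushforward//; exact: mpair.
Qed.

Variable nu : probability A R.

Let cst_nu : A -> pprobability A R := fun=> nu.
Let mcst : measurable_fun setT cst_nu. Proof. exact: measurable_cst. Qed.

(** The measure nu(da) k(a, db) is realised as the composition of a constant kernel [nu] with
    [kernel_graph], evaluated at the arbitrary [point]. It agrees with [m] on rectangles, hence
    everywhere, and the integral over a composition is iterated. *)
Lemma disintegration (m : {measure set (A * B) -> \bar R}) :
  (m setT < +oo)%E ->
  (forall C D, measurable C -> measurable D ->
    m (C `*` D) = \int[nu]_(a in C) k a D)%E ->
  forall f : A * B -> \bar R, (forall x, 0 <= f x)%E -> measurable_fun setT f ->
  (\int[m]_x f x = \int[nu]_a \int[k a]_b f (a, b))%E.
Proof.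
move=> moo mE f f0 mf.
pose l := kprobability mcst.
have mlk C : measurable C -> m C = (mkcomp l kernel_graph point) C.
  move=> mC; apply: finite_measure_prod_unique => // {}C D {}mC mD.
  rewrite mE// /mkcomp /kcomp /l /kprobability /cst_nu.
  rewrite integral_mkcond; apply: eq_integral => a _.
  rewrite kernel_graphE /= patchE; case: ifPn => aC.
    by congr (k a _); apply/seteqP; split => b //=; [|case]; move/set_mem in aC.
  rewrite (_ : _ @^-1` _ = set0) ?measure0//.
  by apply/seteqP; split => b //= -[aC' _]; move: aC; rewrite notin_setE.
rewrite (eq_measure_integral (mkcomp l kernel_graph point)); last first.
  by move=> C mC _; exact: mlk.
rewrite [LHS](integral_kcomp l kernel_graph)//.
by apply: eq_integral => a _; rewrite integral_kernel_graph.
Qed.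

End kernel_graph.

(** * Conditional laws *)

Section disintegration.
Context d d1 d2 (Omega : measurableType d) (A : measurableType d1)
  (B : measurableType d2) (R : realType) (P : probability Omega R)
  (f : Omega -> A) (g : Omega -> B) (mf : measurable_fun setT f)
  (mg : measurable_fun setT g).

(** Serves both sources of randomness in a step: a constant [k] expresses that the noise is
    independent of the past, and [kappa] expresses the conditional law of the state. *)
Lemma integral_disintegration (k : R.-pker A ~> B) :
  (forall C D, measurable C -> measurable D ->
    P (f @^-1` C `&` g @^-1` D) = \int[P]_(w in f @^-1` C) k (f w) D)%E ->
  forall h : A * B -> \bar R, (forall x, 0 <= h x)%E -> measurable_fun setT h ->
  (\int[P]_w h (f w, g w) = \int[P]_w \int[k (f w)]_b h (f w, b))%E.
Proof.
move=> Pk h h0 mh.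
pose mf' := isMeasurableFun.Build _ _ _ _ f mf.
pose f' : {mfun Omega >-> A} := HB.pack f mf'.
have mfg : measurable_fun setT (fun w => (f w, g w)) by exact: measurable_fun_pair.
transitivity (\int[pushforward P (fun w => (f w, g w))]_x h x)%E.
  by rewrite ge0_integral_pushforward.
have law_f (u : A -> \bar R) : (forall a, 0 <= u a)%E ->
    measurable_fun setT u -> (\int[distribution P f']_a u a = \int[P]_w u (f w))%E.
  by move=> u0 mu; rewrite ge0_integral_pushforward.
rewrite (disintegration (k := k) (nu := distribution P f'))//.
- rewrite law_f//.
    by move=> a; exact: integral_ge0.
  exact: measurable_fun_integral_finite_kernel.
- by rewrite /= /pushforward preimage_setT probability_setT ltry.
- move=> C D mC mD.
  rewrite [LHS]Pk// [RHS]integral_mkcond law_f.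
  + by rewrite integral_mkcond; apply: eq_integral => w _; rewrite !patchE.
  + by move=> a; rewrite patchE; case: ifP.
  + apply/(measurable_restrictT _ _).1 => //.
    exact: measurable_funTS (measurable_kernel k _ mD).
Qed.

End disintegration.

(** * The history kernel in terms of the noise *)

Section model_lemmas.
Context (R : realType) (X Y U : pmetricType R)
  (dW dV : measure_display) (W : measurableType dW) (V : measurableType dV)
  (F : borel X * borel U * W -> borel X) (G : borel X * V -> borel Y)
  (muW : probability W R) (muV : probability V R)
  (T : R.-pker (borel X * borel U)%type ~> (borel X))
  (Q : R.-pker (borel X) ~> (borel Y))
  (kappa : R.-pker (borel (history Y U)) ~> (borel X))
  (Pd : R.-pker (borel (history Y U) * borel U)%type ~> (borel (history Y U)))
  (mF : measurable_fun setT F) (mG : measurable_fun setT G)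
  (hT : state_kernel_of F muW T) (hQ : observation_kernel_of G muV Q)
  (hPd : is_history_kernel kappa T Q Pd)
  (Y_compact : compact [set: Y]) (U_compact : compact [set: U]).

Local Notation S := (borel (history Y U)).

Lemma measurable_proj1 n : measurable_fun setT (fun s : S => s.1 n : borel Y).
Proof.
apply: measurable_fun_borel => A oA; apply: borel_open.
by apply: open_comp => // s _; exact: history_proj1_continuous.
Qed.

Lemma measurable_proj2 n : measurable_fun setT (fun s : S => s.2 n : borel U).
Proof.
apply: measurable_fun_borel => A oA; apply: borel_open.
by apply: open_comp => // s _; exact: history_proj2_continuous.
Qed.

Lemma measurable_extend d (Omega : measurableType d) (f : Omega -> S)
    (g : Omega -> borel U) (h : Omega -> borel Y) :
  measurable_fun setT f -> measurable_fun setT g -> measurable_fun setT h ->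
  measurable_fun setT (fun w => extend (f w) (g w) (h w) : S).
Proof.
move=> mf mg mh; apply: measurable_fun_history => // -[|n] //=.
  exact: (measurableT_comp (measurable_proj1 n) mf).
exact: (measurableT_comp (measurable_proj2 n) mf).
Qed.

Definition noise_law : probability (W * V)%type R := (muW \x muV)%E.

Definition history_step (s : S) (u : borel U) (x : borel X) (n : W * V) : S :=
  extend s u (G (F (x, u, n.1), n.2)).

Lemma measurable_history_step d (Omega : measurableType d) (f : Omega -> S)
    (g : Omega -> borel U) (x : Omega -> borel X) (n : Omega -> W * V) :
  measurable_fun setT f -> measurable_fun setT g -> measurable_fun setT x ->
  measurable_fun setT n ->
  measurable_fun setT (fun w => history_step (f w) (g w) (x w) (n w)).
Proof.
move=> mf mg mx mn; apply: measurable_extend => //.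
apply: measurableT_comp => //; apply: measurable_fun_pair.
  apply: measurableT_comp => //; apply: measurable_fun_pair.
    exact: measurable_fun_pair.
  exact: measurableT_comp mn.
exact: measurableT_comp mn.
Qed.

(** [T (x, u)] and [Q x'] are the images of [muW] and [muV] under [F] and [G]. This bridges the
    process, driven by noise, and [Pd], which is given by kernels. *)
Lemma integral_noise (s : S) (u : borel U) (x : borel X) (f : S -> \bar R) :
  (forall z, 0 <= f z)%E -> measurable_fun setT f ->
  (\int[noise_law]_n f (history_step s u x n) =
   \int[T (x, u)]_x' \int[Q x']_y f (extend s u y))%E.
Proof.
move=> f0 mf.
have mfe : measurable_fun setT (fun y : borel Y => f (extend s u y : S)).
  by apply: (measurableT_comp mf); apply: measurable_extend.
have mGx x' : measurable_fun setT (fun v => G (x', v)).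
  by apply: measurableT_comp => //; exact: pair1_measurable.
have mFx : measurable_fun setT (fun w => F (x, u, w)).
  by apply: measurableT_comp => //; exact: pair1_measurable.
have mQ : measurable_fun setT (fun x' => \int[Q x']_y f (extend s u y))%E.
  by apply: measurable_fun_integral_kernel => // ? ?; exact: measurable_kernel.
rewrite [LHS](@fubini_tonelli1 _ _ _ _ _ muW muV
  (fun n => f (history_step s u x n)))//; last first.
  by apply: (measurableT_comp mf); exact: measurable_history_step.
rewrite /fubini_F.
have -> : (\int[T (x, u)]_x' \int[Q x']_y f (extend s u y) =
    \int[pushforward muW (fun w => F (x, u, w))]_x' \int[Q x']_y f (extend s u y))%E.
  by apply: eq_measure_integral => A mA _; exact: hT.
rewrite ge0_integral_pushforward//; last by move=> x' _; exact: integral_ge0.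
apply: eq_integral => w _ /=.
have -> : (\int[Q (F (x, u, w))]_y f (extend s u y) =
    \int[pushforward muV (fun v => G (F (x, u, w), v))]_y f (extend s u y))%E.
  by apply: eq_measure_integral => A mA _; exact: hQ.
by rewrite ge0_integral_pushforward.
Qed.

(* [Pd (s, u)] is the image of [kappa s \x noise_law] under [history_step s u]. *)
Lemma integral_history_kernel (s : S) (u : borel U) (f : S -> \bar R) :
  (forall z, 0 <= f z)%E -> measurable_fun setT f ->
  (\int[Pd (s, u)]_z f z =
   \int[kappa s]_x \int[noise_law]_n f (history_step s u x n))%E.
Proof.
move=> f0 mf.
have mst : measurable_fun setT
    (fun p : borel X * (W * V) => history_step s u p.1 p.2).
  exact: measurable_history_step.
transitivity (\int[pushforward (kernel_probability kappa s \x noise_law)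
    (fun p : borel X * (W * V) => history_step s u p.1 p.2)]_z f z)%E; last first.
  rewrite ge0_integral_pushforward//.
  rewrite [LHS](@fubini_tonelli1 _ _ _ _ _ (kernel_probability kappa s) noise_law
    (fun p => f (history_step s u p.1 p.2)))//.
  exact: (measurableT_comp mf mst).
apply: eq_measure_integral => A mA _.
have f1 z : (0 <= (\1_A z : R)%:E)%E by rewrite lee_fin.
have m1 : measurable_fun setT (EFin \o (\1_A : S -> R)).
  by apply/measurable_EFinP; exact: measurable_indic.
rewrite hPd//; apply: eq_integral => x _ /=.
transitivity (\int[noise_law]_n (\1_A (history_step s u x n) : R)%:E)%E.
  rewrite (integral_noise s u x f1 m1); apply: eq_integral => x' _.
  rewrite (_ : (fun y => _) = EFin \o \1_[set y | A (extend s u y)])//.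
  rewrite integral_indic ?setIT//.
  rewrite -(setTI [set y | _]).
  by apply: measurable_extend => //; exact: measurable_id.
rewrite (_ : (fun n => _) = EFin \o \1_[set n | A (history_step s u x n)])//.
rewrite integral_indic ?setIT//.
  by congr (noise_law _); apply/seteqP; split => n /=; rewrite /xsection /= inE.
rewrite -(setTI [set y | _]).
by apply: measurable_history_step => //; exact: measurable_id.
Qed.

End model_lemmas.

(** * The information process as a controlled chain *)

Section process_lemmas.
Context (R : realType) (X Y U : pmetricType R)
  (dW dV : measure_display) (W : measurableType dW) (V : measurableType dV)
  (F : borel X * borel U * W -> borel X) (G : borel X * V -> borel Y)
  (muW : probability W R) (muV : probability V R)
  (T : R.-pker (borel X * borel U)%type ~> (borel X))
  (Q : R.-pker (borel X) ~> (borel Y))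
  (kappa : R.-pker (borel (history Y U)) ~> (borel X))
  (Pd : R.-pker (borel (history Y U) * borel U)%type ~> (borel (history Y U)))
  (mF : measurable_fun setT F) (mG : measurable_fun setT G)
  (hT : state_kernel_of F muW T) (hQ : observation_kernel_of G muV Q)
  (hPd : is_history_kernel kappa T Q Pd)
  (Y_compact : compact [set: Y]) (U_compact : compact [set: U])
  (d : measure_display) (Omega : measurableType d) (P : probability Omega R)
  (rho : int -> borel (history Y U) -> borel U) (z : system X Y U W V Omega)
  (hz : controlled F G muW muV P z rho) (hk : conditional_law P z kappa).

Local Notation S := (borel (history Y U)).

Lemma measurable_info t : measurable_fun setT (info z t).
Proof.
apply: measurable_fun_history => // n; [exact: (observation_measurable hz)|].
exact: (action_measurable hz).
Qed.

(** [Omega] with [past z t] as its sigma-algebra: membership in [past z t] becomes measurability, so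
    [measurable_fun_history] and pairing apply. [future_type] plays the same role for
    [future_noise]. *)
Let past_type t := g_sigma_algebraType (\bigcup_(r in [set r : int | r <= t])
  sigma_join (sigma_of (state z r))
      (sigma_join (sigma_of (observation z r)) (sigma_of (action z r)))).

Lemma past_info_state t (C : set (S * borel X)) : measurable C ->
  past z t ((fun w => (info z t w, state z t w)) @^-1` C).
Proof.
move=> mC.
have past_gen r (A : set Omega) : r <= t ->
    (sigma_of (state z r) `|` (sigma_of (observation z r) `|` sigma_of (action z r))) A ->
    measurable (A : set (past_type t)).
  move=> rt rA; apply: sub_sigma_algebra; exists r => //.
  apply: sub_sigma_algebra; case: rA => [|rA]; [by left|right].
  exact: sub_sigma_algebra.
have mobs r : r <= t -> measurable_fun setT (observation z r : past_type t -> borel Y).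
  move=> rt _ B mB; rewrite setTI; apply: (past_gen r) => //; right; left.
  by exists B => //; rewrite setTI.
have mact r : r <= t -> measurable_fun setT (action z r : past_type t -> borel U).
  move=> rt _ B mB; rewrite setTI; apply: (past_gen r) => //; right; right.
  by exists B => //; rewrite setTI.
have mst : measurable_fun setT (state z t : past_type t -> borel X).
  move=> _ B mB; rewrite setTI; apply: (past_gen t) => //; left.
  by exists B => //; rewrite setTI.
have minfo : measurable_fun setT (info z t : past_type t -> S).
  apply: measurable_fun_history => // n; [apply: mobs|apply: mact].
    by rewrite gerBl.
  by rewrite -addrA -opprD gerBl addr_ge0.
have mp : measurable_fun setT (fun w : past_type t => (info z t w, state z t w)).
  exact: measurable_fun_pair.
by have := mp measurableT C mC; rewrite setTI.
Qed.

Definition step_noise t (w : Omega) : W * V :=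
  (state_noise z t w, observation_noise z (t + 1) w).

Let future_type t := g_sigma_algebraType (\bigcup_(r in [set r : int | t <= r])
    sigma_join (sigma_of (state_noise z r)) (sigma_of (observation_noise z (r + 1)))).

Lemma future_step_noise t (D : set (W * V)) : measurable D ->
  future_noise z t (step_noise t @^-1` D).
Proof.
move=> mD.
have gen (A : set Omega) :
    (sigma_of (state_noise z t) `|` sigma_of (observation_noise z (t + 1))) A ->
    measurable (A : set (future_type t)).
  move=> tA; apply: sub_sigma_algebra; exists t => //=.
  exact: sub_sigma_algebra.
have m1 : measurable_fun setT (state_noise z t : future_type t -> W).
  by move=> _ B mB; rewrite setTI; apply: gen; left; exists B => //; rewrite setTI.
have m2 : measurable_fun setT (observation_noise z (t + 1) : future_type t -> V).
  by move=> _ B mB; rewrite setTI; apply: gen; right; exists B => //; rewrite setTI.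
have mp : measurable_fun setT (step_noise t : future_type t -> W * V).
  exact: measurable_fun_pair.
by have := mp measurableT D mD; rewrite setTI.
Qed.

Lemma measurable_step_noise t : measurable_fun setT (step_noise t).
Proof.
apply: measurable_fun_pair; first exact: (state_noise_measurable hz).
exact: (observation_noise_measurable hz).
Qed.

Lemma step_noise_law t (D : set (W * V)) : measurable D ->
  P (step_noise t @^-1` D) = noise_law muW muV D.
Proof.
move=> mD; have mn := measurable_step_noise t.
pose n' : {mfun Omega >-> (W * V)%type} := HB.pack (step_noise t)
  (isMeasurableFun.Build _ _ _ _ (step_noise t) mn).
rewrite -[LHS]/(distribution P n' D).
apply: finite_measure_prod_unique => //.
  by rewrite probability_setT ltry.
move=> A B mA mB; rewrite [RHS]product_measure1E//.
(* Mutual independence is used for two indices only, the state noise at [t] and the observation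
   noise at [t + 1], whose events intersect in the rectangle event. *)
have /(_ [:: inl t; inr (t + 1)] (fun i : int + int =>
    if i is inl _ then state_noise z t @^-1` A
    else observation_noise z (t + 1) @^-1` B) isT) := noise_independent hz.
rewrite !big_cons big_nil mule1 (state_noise_law hz)// (observation_noise_law hz)//.
move=> <-; last first.
  move=> i; rewrite !inE => /orP[/eqP->|/eqP->] /=.
    by exists A => //; rewrite setTI.
  by exists B => //; rewrite setTI.
congr (P _); apply/seteqP; split => [w [/= Aw Bw] i /=|w H].
  by rewrite !inE => /orP[/eqP->|/eqP->].
split; first by apply: (H (inl t)); rewrite /= inE eqxx.
by apply: (H (inr (t + 1))); rewrite /= !inE eqxx orbT.
Qed.

Lemma integral_step_noise t (h : S * borel X * (W * V) -> \bar R) :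
  (forall x, 0 <= h x)%E -> measurable_fun setT h ->
  (\int[P]_w h (info z t w, state z t w, step_noise t w) =
   \int[P]_w \int[noise_law muW muV]_n h (info z t w, state z t w, n))%E.
Proof.
move=> h0 mh.
pose c : S * borel X -> pprobability (W * V)%type R := fun=> noise_law muW muV.
have mc : measurable_fun setT c by exact: measurable_cst.
have mis : measurable_fun setT (fun w => (info z t w, state z t w)).
  by apply: measurable_fun_pair; [exact: measurable_info|exact: (state_measurable hz)].
apply: (integral_disintegration mis (measurable_step_noise t)
  (k := kprobability mc)) => //.
move=> C D mC mD.
rewrite (nonanticipative hz (past_info_state mC) (future_step_noise mD)).
rewrite step_noise_law // muleC [RHS]integral_cst//.
by have := mis measurableT C mC; rewrite setTI.
Qed.

Lemma integral_state t (h : S * borel X -> \bar R) :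
  (forall x, 0 <= h x)%E -> measurable_fun setT h ->
  (\int[P]_w h (info z t w, state z t w) =
   \int[P]_w \int[kappa (info z t w)]_x h (info z t w, x))%E.
Proof.
move=> h0 mh.
apply: (integral_disintegration (measurable_info t) (state_measurable hz t)
  (k := kappa)) => //.
move=> C D mC mD.
have [_ _ /(_ (info z t @^-1` C))] := hk t mD.
have mC' : measurable (info z t @^-1` C).
  by have := measurable_info t measurableT mC; rewrite setTI.
have mD' : measurable (state z t @^-1` D).
  by have := state_measurable hz t measurableT mD; rewrite setTI.
move=> H; rewrite setIC -[LHS]integral_indic// -H; last by exists C => //; rewrite setTI.
by apply: eq_integral => w _; rewrite fineK//; exact: finite_kernel_measure.
Qed.

Lemma info_step t w : info z (t + 1) w =
  history_step F G (info z t w) (action z t w) (state z t w) (step_noise t w).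
Proof.
rewrite /history_step /extend /info; congr pair; apply/funext => -[|n].
- by rewrite subr0 (observation_equation hz) (state_equation hz).
- by congr observation; rewrite -addn1 PoszD; ring.
- by congr action; ring.
- by congr action; rewrite -addn1 PoszD; ring.
Qed.

(** Integrated Markov property of S_t: average out the noise first, then the state given the
    information. The disintegrations integrate over all of [Omega], so [B] is absorbed into the
    integrand [h], and the action is replaced by [rho t] of the information. *)
Lemma integral_info_step t (B : set S) (f : S -> \bar R) : measurable B ->
  (forall s, 0 <= f s)%E -> measurable_fun setT f ->
  (\int[P]_(w in info z t @^-1` B) f (info z (t + 1) w) =
   \int[P]_(w in info z t @^-1` B) \int[Pd (info z t w, action z t w)]_s f s)%E.
Proof.
move=> mB f0 mf.
pose g (p : S * borel X * (W * V)) :=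
  f (history_step F G p.1.1 (rho t p.1.1) p.1.2 p.2).
have m11 : measurable_fun setT (fun p : S * borel X * (W * V) => p.1.1).
  by apply: measurableT_comp.
have m12 : measurable_fun setT (fun p : S * borel X * (W * V) => p.1.2).
  by apply: measurableT_comp.
have mg : measurable_fun setT g.
  apply: (measurableT_comp mf); apply: measurable_history_step => //.
  exact: (measurableT_comp (policy_measurable hz t) m11).
have mBX : measurable (B `*` [set: borel X]) by exact: measurableX.
have mBXN : measurable ((B `*` [set: borel X]) `*` [set: W * V]) by exact: measurableX.
pose h := g \_ ((B `*` [set: borel X]) `*` [set: W * V]).
have h0 p : (0 <= h p)%E by rewrite /h patchE; case: ifP => // _; exact: f0.
have mh : measurable_fun setT h.
  by apply/(measurable_restrictT _ _).1 => //; exact: measurable_funTS.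
have hE s x n : h (s, x, n) = if s \in B then g (s, x, n) else 0%E.
  rewrite /h patchE; congr (if _ then _ else _).
  by apply/idP/idP; rewrite !inE => //= -[[]].
have wBE w : (w \in info z t @^-1` B) = (info z t w \in B).
  by apply/idP/idP; rewrite !inE.
pose h2 (p : S * borel X) := (\int[noise_law muW muV]_n h (p, n))%E.
have h20 p : (0 <= h2 p)%E by exact: integral_ge0.
have mh2 : measurable_fun setT h2.
  exact: (@measurable_fun_fubini_tonelli_F _ _ _ _ _ (noise_law muW muV)).
transitivity (\int[P]_w h (info z t w, state z t w, step_noise t w))%E.
  rewrite integral_mkcond; apply: eq_integral => w _.
  by rewrite patchE hE wBE /g /= -(control_equation hz) info_step.
rewrite integral_step_noise// [LHS](integral_state t h20 mh2) [RHS]integral_mkcond.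
apply: eq_integral => w _; rewrite patchE wBE.
rewrite /h2; case: ifPn => wB.
  rewrite (integral_history_kernel mF mG hT hQ hPd)//.
  apply: eq_integral => x _; apply: eq_integral => n _.
  by rewrite hE wB /g /= -(control_equation hz).
rewrite integral0_eq// => x _; rewrite integral0_eq// => n _.
by rewrite hE (negbTE wB).
Qed.

Lemma integral_state_cost t (B : set S) (c : borel X * borel U -> \bar R) :
  measurable B -> (forall p, 0 <= c p)%E -> measurable_fun setT c ->
  (\int[P]_(w in info z t @^-1` B) c (state z t w, action z t w) =
   \int[P]_(w in info z t @^-1` B) \int[kappa (info z t w)]_x c (x, action z t w))%E.
Proof.
move=> mB c0 mc.
pose g (p : S * borel X) := c (p.2, rho t p.1).
have mg : measurable_fun setT g.
  apply: (measurableT_comp mc); apply: measurable_fun_pair => //.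
  exact: (measurableT_comp (policy_measurable hz t)).
have mBX : measurable (B `*` [set: borel X]) by exact: measurableX.
pose h := g \_ (B `*` [set: borel X]).
have h0 p : (0 <= h p)%E by rewrite /h patchE; case: ifP => // _; exact: c0.
have mh : measurable_fun setT h.
  by apply/(measurable_restrictT _ _).1 => //; exact: measurable_funTS.
have hE s x : h (s, x) = if s \in B then g (s, x) else 0%E.
  rewrite /h patchE; congr (if _ then _ else _).
  by apply/idP/idP; rewrite !inE => //= -[].
have wBE w : (w \in info z t @^-1` B) = (info z t w \in B).
  by apply/idP/idP; rewrite !inE.
transitivity (\int[P]_w h (info z t w, state z t w))%E.
  rewrite integral_mkcond; apply: eq_integral => w _.
  by rewrite patchE hE wBE /g /= -(control_equation hz).
rewrite integral_state// [RHS]integral_mkcond.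
apply: eq_integral => w _; rewrite patchE wBE.
case: ifPn => wB.
  by apply: eq_integral => x _; rewrite hE wB /g /= -(control_equation hz).
by rewrite integral0_eq// => x _; rewrite hE (negbTE wB).
Qed.

End process_lemmas.

Lemma continuous_pair (A B C : topologicalType) (f : A -> B) (g : A -> C) :
  continuous f -> continuous g -> continuous (fun a => (f a, g a)).
Proof. by move=> cf cg a; apply: cvg_pair; [exact: cf|exact: cg]. Qed.

Lemma continuous_fst (A B : topologicalType) : continuous (@fst A B).
Proof. by move=> p; exact: cvg_fst. Qed.

Lemma continuous_snd (A B : topologicalType) : continuous (@snd A B).
Proof. by move=> p; exact: cvg_snd. Qed.

(** * The optimality equation *)

Section geometric.
Context (R : realType) (beta K : R) (beta0 : 0 < beta) (beta1 : beta < 1) (K0 : 0 <= K).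

Local Notation M := (K / (1 - beta)).

Lemma geometric_bound_ge0 : 0 <= M.
Proof. by rewrite divr_ge0// subr_ge0 ltW. Qed.

Lemma geometric_small (C e : R) : 0 < e -> exists n, beta ^+ n * C < e.
Proof.
move=> e0; have H : (fun n => beta ^+ n * C) @ \oo --> (0 : R).
  rewrite -[X in _ --> X](mul0r C); apply: cvgM; last exact: cvg_cst.
  by apply: cvg_expr; rewrite gtr0_norm.
have /cvgrPdist_lt/(_ e e0)[n _ /(_ n (leqnn n))] := H.
by rewrite sub0r normrN => /(le_lt_trans (ler_norm _)); exists n.
Qed.

Lemma le_geometric (a b C : R) : (forall n, a <= b + beta ^+ n * C) -> a <= b.
Proof.
move=> ab; apply/ler_addgt0Pr => e e0; have [n nC] := geometric_small C e0.
by apply: le_trans (ab n) _; rewrite lerD2l ltW.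
Qed.

Lemma geometric_increments (v : nat -> R) :
  (forall n, v n <= v n.+1 <= v n + beta ^+ n * K) ->
  exists2 l, v @ \oo --> l & forall n, v n <= l <= v n + beta ^+ n * M.
Proof.
move=> vP.
have ndv : nondecreasing_seq v.
  by apply/nondecreasing_seqP => n; have /andP[] := vP n.
(* Subtracting the remaining tail makes the induction telescope, because [beta ^+ k * K = beta ^+ k
   * M - beta ^+ k.+1 * M]. *)
have vM n k : v (n + k)%N <= v n + beta ^+ n * M - beta ^+ (n + k) * M.
  elim: k => [|k IH]; first by rewrite addn0 addrK.
  rewrite addnS; have /andP[_ h] := vP (n + k)%N.
  apply: le_trans h _; apply: le_trans (lerD IH (lexx _)) _.
  rewrite -addrA lerD2l exprS.
  have -> : beta ^+ (n + k) * K = beta ^+ (n + k) * M * (1 - beta).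
    by rewrite -mulrA divfK// subr_eq0 gt_eqF.
  by rewrite le_eqVlt; apply/orP; left; apply/eqP; ring.
have vM' n m : v m <= v n + beta ^+ n * M.
  have h0 k : 0 <= beta ^+ k * M.
    by rewrite mulr_ge0 ?geometric_bound_ge0// exprn_ge0// ltW.
  case: (leqP n m) => [/subnKC<-|/ltnW mn].
    by apply: le_trans (vM n _) _; rewrite gerBl.
  by apply: le_trans (ndv _ _ mn) _; rewrite lerDl.
have cv : cvgn v.
  apply: nondecreasing_is_cvgn => //; exists (v 0%N + beta ^+ 0 * M) => _ [n _ <-].
  exact: vM'.
exists (limn v) => // n; apply/andP; split; first exact: nondecreasing_cvgn_le.
by apply: limr_le => //; near=> m; exact: vM'.
Unshelve. all: by end_near. Qed.

Lemma geometric_limit_continuous (A : topologicalType) (v : nat -> A -> R)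
    (J : A -> R) (C : R) : (forall n, continuous (v n)) ->
  (forall n a, v n a <= J a <= v n a + beta ^+ n * C) -> continuous J.
Proof.
move=> cv JP a; apply/cvgrPdist_lt => e e0.
have e30 : 0 < e / 3 by rewrite divr_gt0.
have [n nM] := geometric_small C e30.
have /cvgrPdist_lt/(_ _ e30) := cv n a.
apply: filterS => b; rewrite !ltr_norml => /andP[h1 h2].
have /andP[h3 h4] := JP n a; have /andP[h5 h6] := JP n b.
by apply/andP; split; lra.
Qed.

End geometric.

Lemma is_min_le (R : realType) (A : Type) (f g : A -> R) (a b e : R) :
  (forall u, f u <= g u + e) -> is_min f a -> is_min g b -> a <= b + e.
Proof. by move=> fg [_ fa] [[u <-] _]; exact: le_trans (fa u) (fg u). Qed.

(** * The Bellman operator and value iteration *)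

Section value_iteration.
Context (R : realType) (X Y U : pmetricType R)
  (dW dV : measure_display) (W : measurableType dW) (V : measurableType dV)
  (F : borel X * borel U * W -> borel X) (G : borel X * V -> borel Y)
  (muW : probability W R) (muV : probability V R)
  (T : R.-pker (borel X * borel U)%type ~> (borel X))
  (Q : R.-pker (borel X) ~> (borel Y))
  (c : X * U -> R)
  (kappa : R.-pker (borel (history Y U)) ~> (borel X))
  (Pd : R.-pker (borel (history Y U) * borel U)%type ~> (borel (history Y U)))
  (mF : measurable_fun setT F) (mG : measurable_fun setT G)
  (hT : state_kernel_of F muW T) (hQ : observation_kernel_of G muV Q)
  (K : R) (c_ge0 : forall xu, 0 <= c xu) (cK : forall xu, c xu <= K)
  (c_continuous : continuous c)
  (hPd : is_history_kernel kappa T Q Pd)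
  (X_compact : compact [set: X]) (Y_compact : compact [set: Y])
  (U_compact : compact [set: U])
  (Q_continuous : @weakly_continuous R X Y Q)
  (T_continuous : @weakly_continuous R (X * U)%type X T)
  (kappa_continuous : @weakly_continuous R (history Y U) X kappa)
  (beta : R) (beta0 : 0 < beta) (beta1 : beta < 1).

Local Notation S := (history Y U).
Local Notation M := (K / (1 - beta)).

Let K0 : 0 <= K. Proof. exact: le_trans (c_ge0 point) (cK point). Qed.
Let M0 : 0 <= M. Proof. exact: geometric_bound_ge0. Qed.

Let c_norm xu : `|c xu| <= K. Proof. by rewrite ger0_norm. Qed.

Let kappa1 (s : S) : kappa s setT = 1%E. Proof. exact: prob_kernel. Qed.
Let T1 xu : T xu setT = 1%E. Proof. exact: prob_kernel. Qed.
Let Q1 x : Q x setT = 1%E. Proof. exact: prob_kernel. Qed.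
Let Pd1 su : Pd su setT = 1%E. Proof. exact: prob_kernel. Qed.

Lemma measurable_cost : measurable_fun setT (c : borel X * borel U -> R).
Proof.
apply: measurable_fun_real => A oA; apply: open_prod_measurable.
- exact: compact_second_countable.
- exact: compact_second_countable.
- by apply: open_comp => // xu _; exact: c_continuous.
Qed.

Lemma cbar_continuous : continuous (fun p : S * U => cbar c kappa p.1 p.2).
Proof. exact: (weakly_continuous_param X_compact kappa1). Qed.

(** Three uses of [weakly_continuous_param], from the innermost integral outwards ([Q], [T],
    [kappa]), each carrying [(s, u)] as a free parameter. The kernel arguments are identified with
    the parameter by composing with continuous maps. *)
Lemma history_kernel_continuous (J : S -> R) : continuous J ->
  (forall s, 0 <= J s) ->
  continuous (fun p : S * U => \int[Pd (p.1, p.2)]_(s in setT) J s).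
Proof.
move=> cJ J0.
have bS (f : S -> R) : continuous f -> exists N : R, forall s, `|f s| <= N.
  move=> cf.
  exact: (compact_range_bounded (history_compact Y_compact U_compact) cf).
pose h1 (q : X * (S * U)) := \int[Q q.1]_(y in setT) J (extend q.2.1 q.2.2 y).
have cJe : continuous (fun p : Y * (S * U) => J (extend p.2.1 p.2.2 p.1)).
  move=> p; apply: (@continuous_comp _ _ _
    (fun p : Y * (S * U) => extend p.2.1 p.2.2 p.1) J); last exact: cJ.
  apply: (@continuous_comp _ _ _ (fun p : Y * (S * U) => (p.2, p.1))
    (fun q : S * U * Y => extend q.1.1 q.1.2 q.2)); last exact: extend_continuous.
  by apply: continuous_pair; [exact: continuous_snd|exact: continuous_fst].
have ch1 : continuous h1.
  exact: (weakly_continuous_param Y_compact Q1 Q_continuous cJe).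
pose h2 (q : (X * U) * (S * U)) := \int[T q.1]_(x in setT) h1 (x, q.2).
have ch2 : continuous h2.
  exact: (weakly_continuous_param X_compact T1 T_continuous ch1).
(* The action given to [T] is now the one in the parameter, leaving only the state to be integrated
   by [kappa]. *)
have ch2' : continuous (fun q : X * (S * U) => h2 ((q.1, q.2.2), q.2)).
  move=> q; apply: (@continuous_comp _ _ _
    (fun q : X * (S * U) => ((q.1, q.2.2), q.2)) h2); last exact: ch2.
  apply: continuous_pair; last exact: continuous_snd.
  apply: continuous_pair; first exact: continuous_fst.
  by move=> p; apply: (@cvg_comp _ _ _ snd snd); exact: cvg_snd.
pose h3 (q : S * (S * U)) := \int[kappa q.1]_(x in setT) h2 ((x, q.2.2), q.2).
have ch3 : continuous h3.
  exact: (weakly_continuous_param X_compact kappa1 kappa_continuous ch2').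
suff -> : (fun p : S * U => \int[Pd (p.1, p.2)]_(s in setT) J s) = fun p => h3 (p.1, p).
  move=> p; apply: (@continuous_comp _ _ _ (fun p : S * U => (p.1, p)) h3);
    last exact: ch3.
  by apply: continuous_pair; [exact: continuous_fst|move=> ?; exact: cvg_id].
have slice (A B : topologicalType) (f : A * B -> R) (b : B) : continuous f ->
    continuous (fun a => f (a, b)).
  move=> cf a; apply: (@continuous_comp _ _ _ (fun a => (a, b)) f); last exact: cf.
  by apply: continuous_pair => ?; [exact: cvg_id|exact: cvg_cst].
apply/funext => -[s u] /=.
have [N JN] := bS J cJ.
apply: EFin_inj; rewrite (EFin_Rintegral (Pd1 _) (measurable_continuous cJ) JN).
rewrite (integral_history_kernel mF mG hT hQ hPd)//; last first.
  by apply/measurable_EFinP; exact: measurable_continuous.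
have ch2s : continuous (fun x : X => h2 ((x, u), (s, u))).
  exact: (slice _ _ _ (s, u) ch2').
have [N2 h2N] := compact_range_bounded X_compact ch2s.
rewrite (EFin_Rintegral (kappa1 s) (measurable_continuous ch2s) h2N).
apply: eq_integral => x _.
rewrite [LHS](integral_noise mF mG hT hQ Y_compact U_compact s u x
  (f := EFin \o J))//; last first.
  by apply/measurable_EFinP; exact: measurable_continuous.
have ch1s := slice _ _ _ (s, u) ch1.
have [N1 h1N] := compact_range_bounded X_compact ch1s.
rewrite (EFin_Rintegral (T1 _) (measurable_continuous ch1s) h1N).
apply: eq_integral => x' _.
have cJs := slice _ _ _ (s, u) cJe.
have [N3 h3N] := compact_range_bounded Y_compact cJs.
by rewrite (EFin_Rintegral (Q1 _) (measurable_continuous cJs) h3N).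
Qed.

Local Notation bell := (bellman c kappa Pd beta).

Definition bounded_measurable (f : S -> R) :=
  measurable_fun setT (f : borel S -> R) /\ exists N, forall s, `|f s| <= N.

Lemma continuous_bounded_measurable (f : S -> R) :
  continuous f -> bounded_measurable f.
Proof.
move=> cf; split; first exact: measurable_continuous.
exact: (compact_range_bounded (history_compact Y_compact U_compact) cf).
Qed.

Lemma measurable_cost_fst u : measurable_fun setT (fun x : borel X => c (x, u)).
Proof.
exact: (measurableT_comp measurable_cost (pair2_measurable (u : borel U))).
Qed.

Lemma cbar_ge0 s u : 0 <= cbar c kappa s u.
Proof. by apply: Rintegral_ge0 => x _. Qed.

Lemma cbar_le s u : cbar c kappa s u <= K.
Proof.
rewrite -[leRHS](Rintegral_prob_cst (kappa1 s)).
by apply: (Rintegral_mono (kappa1 s) (measurable_cost_fst u) (fun x => c_norm (x, u))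
  (measurable_cst _) (fun=> lexx `|K|)).
Qed.

Lemma bellman_ge0 (f : S -> R) s u : (forall s, 0 <= f s) -> 0 <= bell f s u.
Proof.
move=> f0; rewrite addr_ge0 ?cbar_ge0// mulr_ge0 ?(ltW beta0)//.
exact: Rintegral_ge0.
Qed.

(** Monotonicity and discounting in one statement: [e = 0] gives monotonicity, while
    [e = beta ^+ n * K] or [beta ^+ n * M] propagates the geometric errors. *)
Lemma bellman_le (f g : S -> R) e s u :
  bounded_measurable f -> bounded_measurable g -> (forall s, f s <= g s + e) ->
  bell f s u <= bell g s u + beta * e.
Proof.
move=> [mf [Nf fN]] [mg [Ng gN]] fg.
rewrite /bellman -addrA lerD2l -mulrDr ler_wpM2l ?(ltW beta0)//.
have mge : measurable_fun setT (fun s : borel S => g s + e).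
  exact: measurable_funD.
have geN s' : `|g s' + e| <= Ng + `|e|.
  by apply: le_trans (ler_normD _ _) _; rewrite lerD2r.
apply: le_trans (Rintegral_mono (Pd1 _) mf fN mge geN fg) _.
rewrite RintegralD ?(Rintegral_prob_cst (Pd1 _))//.
  exact: (bounded_integrable (Pd1 _) measurableT mg gN).
exact: (bounded_integrable (Pd1 _) measurableT (measurable_cst e) (fun=> lexx `|e|)).
Qed.

Lemma bellman_continuous (J : S -> R) : continuous J -> (forall s, 0 <= J s) ->
  continuous (fun p : S * U => bell J p.1 p.2).
Proof.
move=> cJ J0 p; apply: cvgD; first exact: cbar_continuous.
by apply: cvgM; [exact: cvg_cst|exact: history_kernel_continuous].
Qed.

(** The default [0] of [xget] is never taken: each iterate is continuous and nonnegative, so the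
    minimum exists by compactness ([value_iterationP]). *)
Definition value_iteration n : S -> R :=
  iter n (fun J s => xget 0 [set m | is_min (bell J s) m]) (fun=> 0).

Local Notation v := value_iteration.

Lemma value_iterationP n : [/\ continuous (v n), forall s, 0 <= v n s &
  forall s, is_min (bell (v n) s) (v n.+1 s)].
Proof.
suff H : continuous (v n) /\ forall s, 0 <= v n s.
  case: H => cv v0; split => // s.
  have [m mP] := is_min_exists s U_compact (bellman_continuous cv v0).
  exact: (@xgetPex _ 0 [set m | is_min (bell (v n) s) m] (ex_intro _ m mP)).
elim: n => [|n [cv v0]].
  have -> : v 0%N = fun=> 0 by [].
  split; first exact: cst_continuous.
  by move=> s; exact: lexx.
have vS s : is_min (bell (v n) s) (v n.+1 s).
  have [m mP] := is_min_exists s U_compact (bellman_continuous cv v0).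
  exact: (@xgetPex _ 0 [set m | is_min (bell (v n) s) m] (ex_intro _ m mP)).
split; first exact: (is_min_continuous U_compact (bellman_continuous cv v0) vS).
by move=> s; have [[u <-] _] := vS s; exact: bellman_ge0.
Qed.

Lemma value_iteration_increment n s : v n s <= v n.+1 s <= v n s + beta ^+ n * K.
Proof.
have cv k : continuous (v k) by have [] := value_iterationP k.
have v0 k s' : 0 <= v k s' by have [] := value_iterationP k.
have vS k s' : is_min (bell (v k) s') (v k.+1 s') by have [] := value_iterationP k.
elim: n s => [|n IH] s.
  have e0 : v 0%N s = 0 by [].
  rewrite e0 v0 add0r expr0 mul1r; have [[u <-] _] := vS 0%N s.
  rewrite /bellman (_ : \int[_]_(s' in setT) _ = 0) ?mulr0 ?addr0 ?cbar_le//.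
  exact: (Rintegral_prob_cst (Pd1 _)).
have bv k := continuous_bounded_measurable (cv k).
apply/andP; split.
  rewrite -[leRHS]addr0; apply: (is_min_le _ (vS n s) (vS n.+1 s)) => u.
  rewrite -[X in _ + X](mulr0 beta); apply: bellman_le => // s'.
  by rewrite addr0; have /andP[] := IH s'.
rewrite exprS -mulrA; apply: (is_min_le _ (vS n.+1 s) (vS n s)) => u.
by apply: bellman_le => // s'; have /andP[] := IH s'.
Qed.

Lemma discounted_cost_equation : exists J : S -> R,
  [/\ continuous J, forall s, 0 <= J s <= M & forall s, is_min (bell J s) (J s)].
Proof.
have cv k : continuous (v k) by have [] := value_iterationP k.
have vS k s' : is_min (bell (v k) s') (v k.+1 s') by have [] := value_iterationP k.
have H s : exists l, forall n, v n s <= l <= v n s + beta ^+ n * M.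
  have [l _ lP] := geometric_increments beta0 beta1 K0 (v := fun n => v n s)
    (fun n => value_iteration_increment n s).
  by exists l.
have [J JP'] := choice H.
have JP n s : v n s <= J s <= v n s + beta ^+ n * M by exact: JP'.
have J_bound s : 0 <= J s <= M by have := JP 0%N s; rewrite /= add0r expr0 mul1r.
have cJ : continuous J := geometric_limit_continuous beta0 beta1 cv JP.
exists J; split => // s.
have J0 s' : 0 <= J s' by have /andP[] := J_bound s'.
have [m mP] := is_min_exists s U_compact (bellman_continuous cJ J0).
(* [J] is so far only a limit of iterates. The minimum [m] of its Bellman function and [J s] are
   both within [beta ^+ n * M] of [v n.+1 s], for every [n]. *)
suff <- : m = J s by [].
have bv k := continuous_bounded_measurable (cv k).
have bJ := continuous_bounded_measurable cJ.
apply/eqP; rewrite eq_le; apply/andP; split.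
  apply: (le_geometric beta0 beta1 (C := M)) => n.
  have h1 : m <= v n.+1 s + beta * (beta ^+ n * M).
    apply: (is_min_le _ mP (vS n s)) => u; apply: bellman_le => // s'.
    by have /andP[] := JP n s'.
  have /andP[h2 _] := JP n.+1 s.
  apply: le_trans h1 _; apply: lerD => //; rewrite ler_piMl ?(ltW beta1)//.
  by rewrite mulr_ge0// exprn_ge0// ltW.
apply: (le_geometric beta0 beta1 (C := M)) => n.
have h1 : v n.+1 s <= m + beta * 0.
  apply: (is_min_le _ (vS n s) mP) => u; apply: bellman_le => // s'.
  by rewrite addr0; have /andP[] := JP n s'.
have /andP[_ h2] := JP n.+1 s.
apply: le_trans h2 _; apply: lerD; first by rewrite mulr0 addr0 in h1.
rewrite exprS -mulrA ler_piMl ?(ltW beta1)//.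
by rewrite mulr_ge0// exprn_ge0// ltW.
Qed.

Lemma minimizing_selector (J : S -> R) : continuous J -> (forall s, 0 <= J s) ->
  (forall s, is_min (bell J s) (J s)) ->
  exists gamma : borel S -> borel U,
    measurable_fun setT gamma /\ forall s, bell J s (gamma s) = J s.
Proof.
move=> cJ J0 Jmin.
have ch : continuous (fun p : S * U => bell J p.1 p.2 - J p.1).
  move=> p; apply: cvgB; first exact: bellman_continuous.
  by apply: (@continuous_comp _ _ _ fst J); [exact: continuous_fst|exact: cJ].
have cD (C : set U) : compact C ->
    closed [set s | [set u | bell J s u - J s <= 0] `&` C !=set0].
  by move=> cC; exact: (closed_sublevel_projection cC ch).
(* Since [J s] is the minimum, this sublevel set is exactly the set of minimizers. *)
have [||C cC|g [mg gP]] := @measurable_selection _ (borel S) R U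
  (fun s => [set u | bell J s u - J s <= 0]) U_compact.
- move=> s; have cu : continuous (fun u => bell J s u - J s).
    move=> u; apply: (@continuous_comp _ _ _ (fun u => (s, u))
      (fun p : S * U => bell J p.1 p.2 - J p.1)); last exact: ch.
    by apply: continuous_pair => ?; [exact: cvg_cst|exact: cvg_id].
  rewrite -[X in closed X]/((fun u => bell J s u - J s) @^-1` [set r | r <= 0]).
  apply: closed_comp; first by move=> u _; exact: cu.
  exact: closed_le.
- by move=> s; have [[u uJ] _] := Jmin s; exists u; rewrite /= uJ subrr.
- apply: borel_closed; apply: cD.
  by apply: subclosed_compact U_compact _.
exists g; split => // s; apply/eqP; rewrite eq_le; apply/andP; split.
  by rewrite -subr_le0; exact: gP.
by have [_] := Jmin s; exact.
Qed.

Lemma measurable_cbar_policy (pol : borel S -> borel U) :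
  measurable_fun setT pol ->
  measurable_fun setT (fun s : borel S => cbar c kappa s (pol s)).
Proof.
move=> mpol; apply: (measurableT_comp (fine_measurable measurableT)).
apply: (measurable_fun_integral_finite_kernel
  (fun p : borel S * borel X => (c (p.2, pol p.1))%:E) kappa).
  by move=> p; rewrite lee_fin.
apply/measurable_EFinP; apply: (measurableT_comp measurable_cost).
by apply: measurable_fun_pair => //; exact: measurableT_comp.
Qed.

Lemma measurable_history_kernel_policy (pol : borel S -> borel U) (f : S -> R) :
  measurable_fun setT pol -> measurable_fun setT (f : borel S -> R) ->
  (forall s, 0 <= f s) ->
  measurable_fun setT (fun s : borel S => \int[Pd (s, pol s)]_(s' in setT) f s').
Proof.
move=> mpol mf f0; apply: (measurableT_comp (fine_measurable measurableT)).
apply: (measurable_fun_integral_kernel (l := fun s : borel S => Pd (s, pol s))).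
- move=> A mA; apply: (measurableT_comp (measurable_kernel Pd A mA)).
  exact: measurable_fun_pair.
- by move=> s; rewrite lee_fin.
- exact/measurable_EFinP.
Qed.

Lemma measurable_bellman_policy (pol : borel S -> borel U) (f : S -> R) :
  measurable_fun setT pol -> measurable_fun setT (f : borel S -> R) ->
  (forall s, 0 <= f s) ->
  measurable_fun setT (fun s : borel S => bell f s (pol s)).
Proof.
move=> mpol mf f0; apply: measurable_funD; first exact: measurable_cbar_policy.
by apply: measurable_funM => //; exact: measurable_history_kernel_policy.
Qed.

(** Compare [f] with [0] at gap [M]; the bound closes up because [K + beta * M = M]. *)
Lemma bellman_le_bound (f : S -> R) s u : bounded_measurable f ->
  (forall s, f s <= M) -> bell f s u <= M.
Proof.
move=> bf fM; have b0 : bounded_measurable (fun=> 0 : R).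
  by split; [exact: measurable_cst|exists 0 => ?; rewrite normr0].
have := @bellman_le f (fun=> 0) M s u bf b0.
have -> : bell (fun=> 0) s u = cbar c kappa s u.
  rewrite /bellman -[RHS]addr0; congr (_ + _).
  by rewrite (Rintegral_prob_cst (Pd1 _)) mulr0.
move=> /(_ _) h; apply: le_trans (h _) _; first by move=> s'; rewrite add0r.
rewrite [leRHS](_ : _ = K + beta * M); last by field; rewrite subr_eq0 gt_eqF.
by rewrite lerD2r; exact: cbar_le.
Qed.

(** * Finite-horizon costs of the chain *)

Local Notation cost := (expected_cost c kappa Pd beta).

Lemma expected_costP n (rho : nat -> S -> U) :
  (forall t, measurable_fun setT (rho t : borel S -> borel U)) ->
  measurable_fun setT (cost n rho : borel S -> R) /\
  forall s, 0 <= cost n rho s <= M.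
Proof.
elim: n rho => [|n IH] rho mrho /=.
  by split; [exact: measurable_cst|move=> s; rewrite lexx M0].
have [mc cP] := IH (fun t => rho t.+1) (fun t => mrho t.+1).
have c0 s : 0 <= cost n (fun t => rho t.+1) s by have /andP[] := cP s.
split; first exact: measurable_bellman_policy.
move=> s; rewrite bellman_ge0//= bellman_le_bound//.
- split => //; exists M => s'; rewrite ger0_norm//.
  by have /andP[] := cP s'.
- by move=> s'; have /andP[] := cP s'.
Qed.

Lemma expected_cost_bounded_measurable n (rho : nat -> S -> U) :
  (forall t, measurable_fun setT (rho t : borel S -> borel U)) ->
  bounded_measurable (cost n rho).
Proof.
move=> mrho; have [mc cP] := expected_costP n mrho.
split => //; exists M => s; have /andP[c0 cM] := cP s.
by rewrite ger0_norm.
Qed.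

Lemma expected_cost_increment n (rho : nat -> S -> U) s :
  (forall t, measurable_fun setT (rho t : borel S -> borel U)) ->
  cost n rho s <= cost n.+1 rho s <= cost n rho s + beta ^+ n * K.
Proof.
elim: n rho s => [|n IH] rho s mrho.
  have [_ /(_ s)/andP[c0 _]] := expected_costP 1 mrho.
  rewrite c0 /= add0r expr0 mul1r /bellman.
  by rewrite (Rintegral_prob_cst (Pd1 _)) mulr0 addr0 cbar_le.
have mrho' t : measurable_fun setT (rho t.+1 : borel S -> borel U) by exact: mrho.
have b k := expected_cost_bounded_measurable k mrho'.
(* Both horizons start with the same action, so the increment comes from the shifted policy and is
   discounted once more. *)
rewrite -[cost n.+2 rho s]/(bell (cost n.+1 (fun t => rho t.+1)) s (rho 0%N s)).
rewrite -[cost n.+1 rho s]/(bell (cost n (fun t => rho t.+1)) s (rho 0%N s)).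
apply/andP; split.
  rewrite -[leRHS]addr0 -[X in _ + X](mulr0 beta); apply: bellman_le => // s'.
  by rewrite addr0; have /andP[] := IH _ s' mrho'.
rewrite exprS -mulrA; apply: bellman_le => // s'.
by have /andP[] := IH _ s' mrho'.
Qed.

(** After [n] steps the recursion ends with [0] where the optimality equation would leave a value of
    at most [M]; discounting makes this the error. *)
Lemma expected_cost_lower_bound (J : S -> R) n (rho : nat -> S -> U) s :
  bounded_measurable J -> (forall s, J s <= M) ->
  (forall s, is_min (bell J s) (J s)) ->
  (forall t, measurable_fun setT (rho t : borel S -> borel U)) ->
  J s <= cost n rho s + beta ^+ n * M.
Proof.
move=> bJ JM Jmin; elim: n rho s => [|n IH] rho s mrho.
  by rewrite /= add0r expr0 mul1r.
have [_ /(_ (rho 0%N s)) h] := Jmin s; apply: le_trans h _ => /=.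
rewrite exprS -mulrA; apply: bellman_le => //.
  by apply: expected_cost_bounded_measurable => t; exact: mrho.
by move=> s'; apply: IH => t; exact: mrho.
Qed.

(** Along [gamma] the optimality equation is an equality at every step, and truncation drops a
    nonnegative terminal value. *)
Lemma expected_cost_selector (J : S -> R) n (gamma : S -> U) s :
  bounded_measurable J -> (forall s, 0 <= J s) ->
  measurable_fun setT (gamma : borel S -> borel U) ->
  (forall s, bell J s (gamma s) = J s) -> cost n (fun=> gamma) s <= J s.
Proof.
move=> bJ J0 mg gJ; elim: n s => [|n IH] s //=.
rewrite -(gJ s) -[leRHS]addr0 -[X in _ + X](mulr0 beta); apply: bellman_le => //.
  exact: expected_cost_bounded_measurable.
by move=> s'; rewrite addr0; exact: IH.
Qed.

Lemma expected_cost_optimal (J : S -> R) (gamma : S -> U) s :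
  bounded_measurable J -> (forall s, 0 <= J s <= M) ->
  (forall s, is_min (bell J s) (J s)) ->
  measurable_fun setT (gamma : borel S -> borel U) ->
  (forall s, bell J s (gamma s) = J s) ->
  (cost n (fun=> gamma) s @[n --> \oo] --> J s) /\
  forall rho : nat -> S -> U,
    (forall t, measurable_fun setT (rho t : borel S -> borel U)) ->
    exists2 l, cost n rho s @[n --> \oo] --> l & J s <= l.
Proof.
move=> bJ J0M Jmin mg gJ.
have JM s' : J s' <= M by have /andP[] := J0M s'.
have J0 s' : 0 <= J s' by have /andP[] := J0M s'.
have lim (rho : nat -> S -> U) :
    (forall t, measurable_fun setT (rho t : borel S -> borel U)) ->
    exists2 l, cost n rho s @[n --> \oo] --> l &
      J s <= l /\ forall n, l <= cost n rho s + beta ^+ n * M.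
  move=> mrho.
  have [l cl lP] := geometric_increments beta0 beta1 K0 (v := fun n => cost n rho s)
    (fun n => expected_cost_increment n s mrho).
  exists l => //; split; last by move=> n; have /andP[] := lP n.
  apply: (le_geometric beta0 beta1 (C := M)) => n.
  apply: le_trans (expected_cost_lower_bound n s bJ JM Jmin mrho) _.
  by rewrite lerD2r; have /andP[] := lP n.
split; last by move=> rho /lim[l cl []]; exists l.
have [l cl [Jl lJ]] := lim (fun=> gamma) (fun=> mg).
suff -> : J s = l by [].
apply/eqP; rewrite eq_le Jl /=; apply: (le_geometric beta0 beta1 (C := M)) => n.
by apply: le_trans (lJ n) _; rewrite lerD2r; exact: expected_cost_selector.
Qed.

(** * Optimality for controlled processes *)

Section controlled_process.
Context (d : measure_display) (Omega : measurableType d) (P : probability Omega R)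
  (rho : int -> borel S -> borel U) (z : system X Y U W V Omega)
  (hz : controlled F G muW muV P z rho) (hk : conditional_law P z kappa).

Let P1 : P setT = 1%E. Proof. exact: probability_setT. Qed.

Let minfo t : measurable_fun setT (info z t).
Proof. exact: (measurable_info Y_compact U_compact hz). Qed.

Definition history_tail (s : S) : S := (fun n => s.1 n.+1, fun n => s.2 n.+1).

Lemma measurable_history_tail :
  measurable_fun setT (history_tail : borel S -> borel S).
Proof.
apply: measurable_fun_history => // n; first exact: measurable_proj1.
exact: measurable_proj2.
Qed.

Lemma info_tail t w : info z t w = history_tail (info z (t + 1) w).
Proof.
rewrite /history_tail /info; congr pair; apply/funext => n /=.
  by congr observation; rewrite -addn1 PoszD; ring.
by congr action; rewrite -addn1 PoszD; ring.
Qed.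

(** Dropping the newest coordinates recovers S_0 from S_t. The one-step identities at time [t]
    require an event of sigma(S_t), while the comparison keeps one event of sigma(S_0)
    throughout. *)
Lemma info_event (B : set (borel S)) (t : nat) : measurable B ->
  exists2 B', measurable (B' : set (borel S)) &
    info z 0 @^-1` B = info z t%:Z @^-1` B'.
Proof.
move=> mB; elim: t => [|t [B' mB' ->]]; first by exists B.
exists (history_tail @^-1` B').
  by have := measurable_history_tail measurableT mB'; rewrite setTI.
by rewrite -addn1 PoszD; apply/funext => w /=; rewrite -info_tail.
Qed.

Let stage t w := c (state z t w, action z t w).

Lemma measurable_stage t : measurable_fun setT (stage t).
Proof.
apply: (measurableT_comp measurable_cost); apply: measurable_fun_pair.
  exact: (state_measurable hz).
exact: (action_measurable hz).
Qed.

Section event.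
Variables (A : set Omega) (B : set (borel S)).
Hypotheses (mB : measurable B) (AB : A = info z 0 @^-1` B).

Let mA : measurable A.
Proof. by rewrite AB; have := minfo 0 measurableT mB; rewrite setTI. Qed.

Let integrable_bounded (f : Omega -> R) (N : R) : measurable_fun setT f ->
  (forall w, `|f w| <= N) -> P.-integrable A (EFin \o f).
Proof. exact: bounded_integrable. Qed.

Lemma Rintegral_stage (t : nat) :
  \int[P]_(w in A) stage t%:Z w =
  \int[P]_(w in A) cbar c kappa (info z t%:Z w) (action z t%:Z w).
Proof.
have [B' mB' AB'] := info_event t mB; rewrite AB AB' /Rintegral; congr fine.
rewrite [LHS](integral_state_cost Y_compact U_compact hz hk t
  (c := EFin \o c))//; last first.
  by apply/measurable_EFinP; exact: measurable_cost.
apply: eq_integral => w _.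
by rewrite (EFin_Rintegral (kappa1 _) (measurable_cost_fst _) (fun x => c_norm (x, _))).
Qed.

Lemma Rintegral_info_step (t : nat) (f : S -> R) :
  bounded_measurable f -> (forall s, 0 <= f s) ->
  \int[P]_(w in A) f (info z (t%:Z + 1) w) =
  \int[P]_(w in A) \int[Pd (info z t%:Z w, action z t%:Z w)]_(s in setT) f s.
Proof.
move=> [mf [N fN]] f0.
have [B' mB' AB'] := info_event t mB; rewrite AB AB' /Rintegral; congr fine.
rewrite [LHS](integral_info_step mF mG hT hQ hPd Y_compact U_compact hz hk t
  (f := EFin \o f))//; last first.
  exact/measurable_EFinP.
by apply: eq_integral => w _; rewrite (EFin_Rintegral (Pd1 _) mf fN).
Qed.

(** The action is [rho t] of the information, so measurability along the policy is enough and joint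
    measurability of [h] is avoided. *)
Let measurable_info_policy (t : int) (h : S -> U -> R) :
  measurable_fun setT (fun s : borel S => h s (rho t s)) ->
  measurable_fun setT (fun w => h (info z t w) (action z t w)).
Proof.
move=> mh; rewrite (_ : (fun w => _) = (fun s => h s (rho t s)) \o info z t).
  exact: measurableT_comp.
by apply/funext => w /=; rewrite (control_equation hz).
Qed.

Variable J : S -> R.
Hypotheses (bJ : bounded_measurable J) (J0M : forall s, 0 <= J s <= M).

Let J0 s : 0 <= J s. Proof. by have /andP[] := J0M s. Qed.
Let JM s : J s <= M. Proof. by have /andP[] := J0M s. Qed.
Let J_norm s : `|J s| <= M. Proof. by rewrite ger0_norm. Qed.

Let mJinfo t : measurable_fun setT (fun w => J (info z t w)).
Proof. exact: (measurableT_comp bJ.1). Qed.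

Lemma measurable_bellman_info t :
  measurable_fun setT (fun w => bell J (info z t w) (action z t w)).
Proof.
apply: (@measurable_info_policy t (bell J)).
by apply: measurable_bellman_policy => //; [exact: (policy_measurable hz)|exact: bJ.1].
Qed.

Lemma bellman_norm s u : `|bell J s u| <= M.
Proof. by rewrite ger0_norm ?bellman_ge0// bellman_le_bound. Qed.

Lemma Rintegral_bellman (t : nat) :
  \int[P]_(w in A) bell J (info z t%:Z w) (action z t%:Z w) =
  \int[P]_(w in A) stage t%:Z w + beta * \int[P]_(w in A) J (info z (t%:Z + 1) w).
Proof.
have mpol := policy_measurable hz t.
have mc : measurable_fun setT (fun w => cbar c kappa (info z t%:Z w) (action z t%:Z w)).
  exact: (measurable_info_policy (measurable_cbar_policy mpol)).
have mk : measurable_fun setT (fun w =>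
    \int[Pd (info z t%:Z w, action z t%:Z w)]_(s in setT) J s).
  apply: (measurable_info_policy (h := fun s u => \int[Pd (s, u)]_(s' in setT) J s')).
  by apply: measurable_history_kernel_policy => //; exact: bJ.1.
have cN w : `|cbar c kappa (info z t%:Z w) (action z t%:Z w)| <= K.
  by rewrite ger0_norm ?cbar_ge0 ?cbar_le.
have kN w : `|\int[Pd (info z t%:Z w, action z t%:Z w)]_(s in setT) J s| <= M.
  rewrite ger0_norm; last exact: Rintegral_ge0.
  rewrite -[leRHS](Rintegral_prob_cst (Pd1 (info z t%:Z w, action z t%:Z w))).
  exact: (Rintegral_mono (Pd1 _) bJ.1 J_norm (measurable_cst _) (fun=> lexx `|M|)).
rewrite Rintegral_stage Rintegral_info_step// -RintegralZl//; last first.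
  exact: integrable_bounded mk kN.
rewrite -RintegralD//; first exact: integrable_bounded mc cN.
apply: (@integrable_bounded _ (beta * M)); first exact: measurable_funM.
by move=> w; rewrite normrM gtr0_norm// ler_wpM2l// ltW.
Qed.

Let partial n w := \sum_(0 <= t < n) beta ^+ t * stage t%:Z w.

Lemma measurable_partial n : measurable_fun setT (partial n).
Proof.
apply: measurable_sum => t; apply: measurable_funM => //.
exact: measurable_stage.
Qed.

Let partial_increment w k :
  partial k w <= partial k.+1 w <= partial k w + beta ^+ k * K.
Proof.
have b0 : 0 <= beta ^+ k by rewrite exprn_ge0// ltW.
rewrite /partial big_nat_recr//=; apply/andP; split.
  by rewrite lerDl mulr_ge0// c_ge0.
by rewrite lerD2l ler_wpM2l// cK.
Qed.

Lemma total_costP w n : [/\ 0 <= partial n w, partial n w <= M,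
  partial n w <= total_cost z c beta w &
  total_cost z c beta w <= partial n w + beta ^+ n * M].
Proof.
have [l cl lP] := geometric_increments beta0 beta1 K0 (partial_increment w).
(* The geometric bound makes the series converge, so the [limn] in [total_cost] is a genuine
   limit. *)
have <- : l = total_cost z c beta w by apply/esym/cvg_lim => //; exact: cl.
have /andP[h1 h2] := lP 0%N; have /andP[h3 h4] := lP n.
rewrite /partial big_nil add0r expr0 mul1r in h1 h2.
split => //; last exact: le_trans h3 h2.
by apply: sumr_ge0 => t _; rewrite mulr_ge0 ?exprn_ge0 ?(ltW beta0)// c_ge0.
Qed.

Lemma total_cost_norm w : `|total_cost z c beta w| <= M.
Proof.
have [h1 _ h3 _] := total_costP w 0; rewrite ger0_norm; last exact: le_trans h1 h3.
by have [_ _ _] := total_costP w 0; rewrite /partial big_nil add0r expr0 mul1r.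
Qed.

Lemma total_cost_cvg w : partial n w @[n --> \oo] --> total_cost z c beta w.
Proof.
have [l cl _] := geometric_increments beta0 beta1 K0 (partial_increment w).
by have <- : l = total_cost z c beta w by apply/esym/cvg_lim => //; exact: cl.
Qed.

Lemma measurable_total_cost : measurable_fun setT (total_cost z c beta).
Proof.
apply: (measurable_fun_cvg (h := partial)) => [n|w _]; first exact: measurable_partial.
exact: total_cost_cvg.
Qed.

Lemma total_cost_integrable : P.-integrable A (EFin \o total_cost z c beta).
Proof. exact: integrable_bounded measurable_total_cost total_cost_norm. Qed.

Let partial_integrable n : P.-integrable A (EFin \o partial n).
Proof.
apply: (@integrable_bounded _ M); first exact: measurable_partial.
by move=> w; have [h1 h2 _ _] := total_costP w n; rewrite ger0_norm.
Qed.

Let J_integrable t : P.-integrable A (EFin \o (fun w => J (info z t w))).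
Proof. exact: (@integrable_bounded _ M). Qed.

Let J_integral_bounds t : 0 <= \int[P]_(w in A) J (info z t w) <= M.
Proof.
rewrite Rintegral_ge0//=; apply: le_trans (le_Rintegral mA (J_integrable t) _ _) _.
- exact: (@integrable_bounded (cst M) `|M|).
- by move=> w _; exact: JM.
- rewrite Rintegral_cst// ler_piMr// -lee_fin fineK ?fin_num_measure//.
  exact: probability_le1.
Qed.

Let integral_partial_total n :
  \int[P]_(w in A) partial n w <= \int[P]_(w in A) total_cost z c beta w <=
  \int[P]_(w in A) partial n w + beta ^+ n * M.
Proof.
have bM0 : 0 <= beta ^+ n * M by rewrite mulr_ge0// exprn_ge0// ltW.
apply/andP; split.
  apply: le_Rintegral => //; first exact: total_cost_integrable.
  by move=> w _; have [] := total_costP w n.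
apply: (@le_trans _ _ (\int[P]_(w in A) (partial n w + beta ^+ n * M))).
  apply: le_Rintegral => //; first exact: total_cost_integrable.
    apply: (@integrable_bounded _ (M + beta ^+ n * M)).
      by apply: measurable_funD => //; exact: measurable_partial.
    move=> w; have [h1 h2 _ _] := total_costP w n.
    by rewrite ger0_norm ?addr_ge0// lerD2r.
  by move=> w _; have [] := total_costP w n.
rewrite RintegralD//; last first.
  exact: (@integrable_bounded (cst (beta ^+ n * M)) `|beta ^+ n * M|).
rewrite lerD2l Rintegral_cst// ler_piMr// -lee_fin fineK ?fin_num_measure//.
exact: probability_le1.
Qed.

Let integral_partial0 : \int[P]_(w in A) partial 0 w = 0.
Proof.
transitivity (\int[P]_(w in A) (0 : R)); last by rewrite Rintegral_cst// mul0r.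
by apply: eq_Rintegral => w _; rewrite /partial big_nil.
Qed.

Let integral_partialS n : \int[P]_(w in A) partial n.+1 w =
  \int[P]_(w in A) partial n w + beta ^+ n * \int[P]_(w in A) stage n%:Z w.
Proof.
have ms := measurable_stage n%:Z.
have sN w : `|stage n%:Z w| <= K by exact: c_norm.
have Is := integrable_bounded ms sN.
rewrite -RintegralZl// -RintegralD//.
  by apply: eq_Rintegral => w _; rewrite /partial big_nat_recr.
apply: (@integrable_bounded _ (beta ^+ n * K)); first exact: measurable_funM.
move=> w; rewrite normrM ger0_norm ?exprn_ge0 ?(ltW beta0)//.
by rewrite ler_wpM2l// exprn_ge0// ltW.
Qed.

Hypothesis Jmin : forall s u, J s <= bell J s u.

Lemma value_le_integral_total_cost :
  \int[P]_(w in A) J (info z 0 w) <= \int[P]_(w in A) total_cost z c beta w.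
Proof.
(* Pay [n] stages and then the terminal value [J]. Each step applies [Jmin] under the integral at
   time [n] and splits the result with [Rintegral_bellman]; the terminal term vanishes
   geometrically. *)
have H n : \int[P]_(w in A) J (info z 0 w) <=
    \int[P]_(w in A) partial n w + beta ^+ n * \int[P]_(w in A) J (info z n%:Z w).
  elim: n => [|n IH].
    by rewrite expr0 mul1r integral_partial0 add0r.
  apply: le_trans IH _; rewrite integral_partialS -addrA lerD2l exprSr -mulrA -mulrDr.
  rewrite ler_wpM2l ?exprn_ge0 ?(ltW beta0)// -addn1 PoszD -Rintegral_bellman.
  apply: le_Rintegral => //.
  apply: (@integrable_bounded _ M); first exact: measurable_bellman_info.
  by move=> w; exact: bellman_norm.
apply: (le_geometric beta0 beta1 (C := M)) => n.
apply: le_trans (H n) _; apply: lerD; first by have /andP[] := integral_partial_total n.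
by rewrite ler_wpM2l ?exprn_ge0 ?(ltW beta0)//; have /andP[] := J_integral_bounds n.
Qed.

Lemma value_eq_integral_total_cost :
  (forall (t : nat) s, J s = bell J s (rho t%:Z s)) ->
  \int[P]_(w in A) J (info z 0 w) = \int[P]_(w in A) total_cost z c beta w.
Proof.
move=> Jrho; apply/eqP; rewrite eq_le value_le_integral_total_cost /=.
(* The same telescoping, now exact; the nonnegative terminal term is then dropped. *)
have H n : \int[P]_(w in A) J (info z 0 w) =
    \int[P]_(w in A) partial n w + beta ^+ n * \int[P]_(w in A) J (info z n%:Z w).
  elim: n => [|n IH].
    by rewrite expr0 mul1r integral_partial0 add0r.
  rewrite IH integral_partialS -addrA exprSr -mulrA -mulrDr.
  rewrite -addn1 PoszD -Rintegral_bellman; congr (_ + _ * _).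
  by apply: eq_Rintegral => w _; rewrite (control_equation hz) -Jrho.
apply: (le_geometric beta0 beta1 (C := M)) => n.
have /andP[_ h] := integral_partial_total n; apply: le_trans h _.
rewrite lerD2r (H n) lerDl mulr_ge0 ?exprn_ge0 ?(ltW beta0)//.
by have /andP[] := J_integral_bounds n.
Qed.

End event.

Variable J : S -> R.
Hypotheses (bJ : bounded_measurable J) (J0M : forall s, 0 <= J s <= M)
  (Jmin : forall s u, J s <= bell J s u).

Let EFin_integral (A : set Omega) (f : Omega -> R) :
  measurable A -> P.-integrable A (EFin \o f) ->
  (\int[P]_(w in A) (f w)%:E = (\int[P]_(w in A) f w)%:E)%E.
Proof. by move=> mA If; rewrite fineK//; exact: integrable_fin_num. Qed.

Let J_info_integrable A : measurable A ->
  P.-integrable A (EFin \o (J \o info z 0)).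
Proof.
move=> mA; apply: (bounded_integrable P1 mA (M := M)).
  exact: (measurableT_comp bJ.1).
by move=> w; have /andP[J0 JM] := J0M (info z 0 w); rewrite ger0_norm.
Qed.

Lemma value_is_cond_exp : (forall (t : nat) s, J s = bell J s (rho t%:Z s)) ->
  is_cond_exp P (sigma_of (info z 0)) (total_cost z c beta) (J \o info z 0).
Proof.
move=> Jrho; split.
- move=> C mC; exists (J @^-1` C); last by rewrite setTI.
  by have := bJ.1 measurableT C mC; rewrite setTI.
- exact: J_info_integrable.
- move=> _ [B mB <-]; rewrite setTI.
  have mA : measurable (info z 0 @^-1` B).
    by have := minfo 0 measurableT mB; rewrite setTI.
  rewrite [LHS](EFin_integral mA (J_info_integrable mA)).
  rewrite (EFin_integral mA (total_cost_integrable mB erefl)).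
  by congr EFin; exact: (value_eq_integral_total_cost mB erefl bJ J0M Jmin Jrho).
Qed.

(** Test on the event of sigma(S_0) where [J > h]: the integral of [J - h] there is nonnegative by
    choice of the event and nonpositive by the lower bound on the total cost. A positive function
    with zero integral lives on a null event. *)
Lemma value_le_cond_exp (h : borel S -> R) : measurable_fun setT h ->
  is_cond_exp P (sigma_of (info z 0)) (total_cost z c beta) (h \o info z 0) ->
  \forall w \ae P, J (info z 0 w) <= h (info z 0 w).
Proof.
move=> mh [_ Ih hP].
pose D w := J (info z 0 w) - h (info z 0 w).
have mD0 : measurable_fun setT (fun s : borel S => J s - h s).
  by apply: measurable_funB => //; exact: bJ.1.
have mD : measurable_fun setT D by exact: (measurableT_comp mD0).
pose B := [set s : borel S | 0 < J s - h s].
have mB : measurable B.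
  have := mD0 measurableT _ (measurable_itv `]0, +oo[); rewrite setTI.
  by congr measurable; apply/seteqP; split => s; rewrite /= in_itv/= andbT.
pose A := info z 0 @^-1` B.
have mA : measurable A by have := minfo 0 measurableT mB; rewrite setTI.
have IJ := J_info_integrable mA.
have IhA : P.-integrable A (EFin \o (h \o info z 0)).
  exact: integrableS Ih.
have ID : P.-integrable A (EFin \o D) by exact: (integrableB mA IJ IhA).
have D0 : \int[P]_(w in A) D w = 0.
  apply/eqP; rewrite eq_le; apply/andP; split; last first.
    by apply: Rintegral_ge0 => w /ltW.
  rewrite [leLHS](RintegralB mA IJ IhA) subr_le0.
  apply: le_trans (value_le_integral_total_cost mB erefl bJ J0M Jmin) _.
  rewrite -lee_fin -(EFin_integral mA (total_cost_integrable mB erefl)).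
  rewrite -(EFin_integral mA IhA) hP//.
  by exists B => //; rewrite setTI.
have mDA : measurable_fun A (EFin \o D).
  by apply/measurable_EFinP; exact: measurable_funTS.
have := (ae_eq_integral_abs P mA mDA).1.
have -> : (\int[P]_(w in A) `|(EFin \o D) w| = 0)%E.
  transitivity (\int[P]_(w in A) (D w)%:E)%E; last by rewrite EFin_integral// D0.
  by apply: eq_integral => w /set_mem Aw; rewrite /= gtr0_norm.
move=> /(_ erefl); apply: filterS => w H.
rewrite leNgt; apply/negP; rewrite -subr_gt0 => Dw.
by have := H Dw => -[D0w]; move: Dw; rewrite -/(D w) D0w ltxx.
Qed.

End controlled_process.

End value_iteration.

Theorem theorem8 (R : realType) (X Y U : pmetricType R)
  (dW dV : measure_display) (W : measurableType dW) (V : measurableType dV)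
  (F : borel X * borel U * W -> borel X) (G : borel X * V -> borel Y)
  (muW : probability W R) (muV : probability V R)
  (T : R.-pker (borel X * borel U)%type ~> (borel X))
  (Q : R.-pker (borel X) ~> (borel Y))
  (c : X * U -> R)
  (kappa : R.-pker (borel (history Y U)) ~> (borel X))
  (Pd : R.-pker (borel (history Y U) * borel U)%type ~> (borel (history Y U)))
  (mF : measurable_fun setT F) (mG : measurable_fun setT G)
  (hT : state_kernel_of F muW T) (hQ : observation_kernel_of G muV Q)
  (c_ge0 : forall xu, 0 <= c xu)
  (c_bounded : exists M, forall xu, c xu <= M)
  (c_continuous : continuous c)
  (kappa_law : forall (d : measure_display) (Omega : measurableType d)
     (P : probability Omega R) (rho : int -> borel (history Y U) -> borel U)
     (z : system X Y U W V Omega),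
     controlled F G muW muV P z rho -> conditional_law P z kappa)
  (hPd : is_history_kernel kappa T Q Pd)
  (X_compact : compact [set: X]) (Y_compact : compact [set: Y])
  (U_compact : compact [set: U])
  (Q_continuous : @weakly_continuous R X Y Q)
  (T_continuous : @weakly_continuous R (X * U)%type X T)
  (kappa_continuous : @weakly_continuous R (history Y U) X kappa)
  (filter_info : exists g : borel (history Y U) -> pprobability (borel X) R,
     measurable_fun setT g /\
     forall (d : measure_display) (Omega : measurableType d)
       (P : probability Omega R) (rho : int -> borel (history Y U) -> borel U)
       (z : system X Y U W V Omega)
       (pi : int -> Omega -> pprobability (borel X) R),
       controlled F G muW muV P z rho -> is_filter P z pi ->
       forall t, \forall w \ae P, forall A : set (borel X), measurable A ->
         g (info z t w) A = pi t w A)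
  (beta : R) (beta_gt0 : 0 < beta) (beta_lt1 : beta < 1) :
  exists (J : borel (history Y U) -> R) (gamma : borel (history Y U) -> borel U),
    [/\ measurable_fun setT J /\ (exists M, forall s, `|J s| <= M),
        forall s, is_min (bellman c kappa Pd beta J s) (J s),
        measurable_fun setT gamma /\
          (forall s, bellman c kappa Pd beta J s (gamma s) = J s),
        (forall (d : measure_display) (Omega : measurableType d)
           (P : probability Omega R)
           (rho : int -> borel (history Y U) -> borel U)
           (z : system X Y U W V Omega),
           controlled F G muW muV P z rho ->
           ((forall t : nat, rho t%:Z = gamma) ->
             is_cond_exp P (sigma_of (info z 0)) (total_cost z c beta)
               (J \o info z 0)) /\
           (forall h : borel (history Y U) -> R, measurable_fun setT h ->
             is_cond_exp P (sigma_of (info z 0)) (total_cost z c beta)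
               (h \o info z 0) ->
             \forall w \ae P, J (info z 0 w) <= h (info z 0 w))) &
        (forall s : history Y U,
           (expected_cost c kappa Pd beta n (fun=> gamma) s @[n --> \oo] --> J s)
           /\
           forall rho : nat -> borel (history Y U) -> borel U,
             (forall t, measurable_fun setT (rho t)) ->
             exists2 l,
               expected_cost c kappa Pd beta n rho s @[n --> \oo] --> l
               & J s <= l)].
Proof.
have [K cK] := c_bounded.
have [J [cJ J0M Jmin]] := discounted_cost_equation mF mG hT hQ c_ge0 cK c_continuous
  hPd X_compact Y_compact U_compact Q_continuous T_continuous kappa_continuous
  beta_gt0 beta_lt1.
have J0 s : 0 <= J s by have /andP[] := J0M s.
have [gamma [mgamma gammaJ]] := minimizing_selector mF mG hT hQ c_continuous
  hPd X_compact Y_compact U_compact Q_continuous T_continuous kappa_continuous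
  cJ J0 Jmin.
have bJ := continuous_bounded_measurable Y_compact U_compact cJ.
have Jle s u : J s <= bellman c kappa Pd beta J s u by have [_] := Jmin s; exact.
exists J, gamma; split => //.
- move=> d Omega P rho z hz; have hk := kappa_law _ _ _ _ _ hz; split.
    move=> rho_gamma; apply: (value_is_cond_exp mF mG hT hQ c_ge0 cK c_continuous hPd
      X_compact Y_compact U_compact beta_gt0 beta_lt1 hz hk bJ J0M Jle) => t s.
    by rewrite rho_gamma gammaJ.
  move=> h mh hP; exact: (value_le_cond_exp mF mG hT hQ c_ge0 cK c_continuous hPd
    X_compact Y_compact U_compact beta_gt0 beta_lt1 hz hk bJ J0M Jle mh hP).
- move=> s; exact: (expected_cost_optimal c_ge0 cK c_continuous X_compact U_compact
    beta_gt0 beta_lt1 s bJ J0M Jmin mgamma gammaJ).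
Qed.
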